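(* Let $(b,c)$ be a connected transient graph over $X$. Then the following assertions are equivalent. (ii) $Gc=1$ (identically on $X$). (v) For any non-thick $A\subseteq X$ and some (equivalently, all) $x\in X$ $$\sum_{y\in X\setminus A}G^b(x,y)c(y)=\infty.$$ (v.a) There exists no decomposition $c=c_1+c_2$ with $c_1,c_2\ge0$ such that $c_1$ is supported on some non-thick set and $G^bc_2$ is bounded. (v.b) There exists no decomposition $c=c_1+c_2$ with $c_1,c_2\ge0$ such that $c_1$ is supported on some non-thick set and $G^bc_2$ is finite (everywhere on $X$). In (v.a) and (v.b) it suffices to exclude decompositions of the form $c_1=1_Ac$ and $c_2=1_{X\setminus A}c$ for some non-thick $A\subseteq X$.
   Context: Let $X$ be a countable set. A graph $(b,c)$ over $X$ consists of a symmetric function $b:X\times X\to[0,\infty)$ with $b(x,x)=0$ and $\sum_{y\in X}b(x,y)<\infty$ for all $x\in X$, and a function $c:X\to[0,\infty)$ (the killing term); one writes $b$ for $(b,0)$. The graph is connected if for all $x,y\in X$ there are $x=y_1,\dots,y_{n+1}=y$ with $b(y_i,y_{i+1})>0$ for $1\le i\le n$. Let $\mathcal{F}=\{f:X\to\mathbb{R}\mid \sum_y b(x,y)|f(y)|<\infty \text{ for all }x\}$ and, for $f\in\mathcal{F}$, $\mathcal{L}_{b,c}f(x)=\sum_y b(x,y)(f(x)-f(y))+c(x)f(x)$. Let $\mathcal{Q}(f)=\frac12\sum_{x,y}b(x,y)(f(x)-f(y))^2+\sum_x c(x)f(x)^2$, $\mathcal{D}=\{f:X\to\mathbb{R}\mid\mathcal{Q}(f)<\infty\}$,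 and let $\mathcal{D}_0$ be the closure of the finitely supported functions in $\mathcal{D}$ with respect to $\|f\|_o=\sqrt{\mathcal{Q}(f)+|f(o)|^2}$ for a fixed $o\in X$. Let $L=L_{b,c}$ be the self-adjoint operator on $\ell^2(X)$ (counting measure) associated with the restriction of $\mathcal{Q}$ to $\mathcal{D}_0\cap\ell^2(X)$. The connected graph $(b,c)$ is transient if for every $y\in X$ there is a unique $G_y\in\mathcal{D}_0$ with $\mathcal{L}_{b,c}G_y=1_{\{y\}}$. Then $G(x,y)=G_y(x)=\int_0^\infty(e^{-tL}1_{\{y\}})(x)\,dt$ is the Green function and $Gf(x)=\sum_yG(x,y)f(y)\in[0,\infty]$ for $f\ge0$. $G^b$ denotes the Green function, and Green operator, of $(b,0)$, with $G^b(x,y)=\int_0^\infty(e^{-tL_{b,0}}1_{\{y\}})(x)\,dt$; if $(b,0)$ is not transient, $G^b(x,y)=\infty$, and $\infty\cdot0=0$. A set $A\subseteq X$ is thick (with respect to $b$) if for any $s\in\mathcal{F}$ with $s\ge0$ and $\mathcal{L}_{b,0}s\ge0$ the inequality $s\ge1$ on $A$ implies $s\ge1$ on $X$; otherwise it is non-thick. *)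

(* Defs.v *)
From HB Require Import structures.
From mathcomp Require Import all_boot all_order all_algebra.
From mathcomp Require Import all_classical all_reals all_analysis.

Set Implicit Arguments.
Unset Strict Implicit.
Unset Printing Implicit Defensive.

Import Order.TTheory GRing.Theory Num.Theory.
Local Open Scope classical_set_scope.
Local Open Scope ring_scope.

Section Graphs.
Context {R : realType} {X : countType}.
Implicit Types (b : X -> X -> R) (c f g : X -> R) (A : set X) (o : X).

Record is_graph b c : Prop := IsGraph {
  graph_edge_ge0 : forall x y, 0 <= b x y;
  graph_edge_sym : forall x y, b x y = b y x;
  graph_edge_diag : forall x, b x x = 0;
  graph_edge_sum : forall x, (\esum_(y in [set: X]) (b x y)%:E < +oo)%E;
  graph_kill_ge0 : forall x, 0 <= c x
}.

Definition graph_connected b : Prop :=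
  forall x y, exists p : seq X,
    path (fun u v => 0 < b u v) x p /\ last x p = y.

(* Sum of an absolutely summable real family; [esum] by itself is meaningful
   for nonnegative terms only. *)
Definition signed_sum f : R :=
  fine ((\esum_(x in [set: X]) (f^\+ x)%:E) -
        (\esum_(x in [set: X]) (f^\- x)%:E))%E.

Definition formal_domain b : set (X -> R) :=
  [set f | forall x, (\esum_(y in [set: X]) (b x y * `|f y|)%:E < +oo)%E].

(* Meaningful for [f] in [formal_domain b]. *)
Definition laplacian b c f (x : X) : R :=
  signed_sum (fun y => b x y * (f x - f y)) + c x * f x.

Definition energy b c f : \bar R :=
  ((2^-1)%:E *
     (\esum_(p in [set: X * X]) (b p.1 p.2 * (f p.1 - f p.2) ^+ 2)%:E) +
   \esum_(x in [set: X]) (c x * f x ^+ 2)%:E)%E.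

Definition finite_energy b c : set (X -> R) :=
  [set f | (energy b c f < +oo)%E].

Definition energy_norm o b c f : \bar R :=
  sqrte (energy b c f + (`|f o| ^+ 2)%:E)%E.

Definition finitely_supported : set (X -> R) :=
  [set f | finite_set [set x | f x != 0]].

Definition finite_energy0 o b c : set (X -> R) :=
  [set f | finite_energy b c f /\
    forall e : R, 0 < e ->
      exists2 phi, finitely_supported phi &
        (energy_norm o b c (fun x => f x - phi x)%R < e%:E)%E].

Definition is_green o b c (y : X) : set (X -> R) :=
  [set g | [/\ finite_energy0 o b c g, formal_domain b g &
    forall x, laplacian b c g x = \1_[set y] x]].

Definition transient o b c : Prop :=
  forall y, exists! g, is_green o b c y g.

(* The value is [+oo] for graphs that are not transient. *)
Definition green o b c (x y : X) : \bar R :=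
  if `[< transient o b c >] then (xget (cst 0) (is_green o b c y) x)%:E
  else +oo%E.

(* Meaningful for [f >= 0]; in [\bar R], [+oo * 0 = 0]. *)
Definition green_op o b c f (x : X) : \bar R :=
  (\esum_(y in [set: X]) (green o b c x y * (f y)%:E))%E.

Definition no_killing : X -> R := cst 0.

Definition thick b A : Prop :=
  forall s, formal_domain b s -> (forall x, 0 <= s x) ->
    (forall x, 0 <= laplacian b no_killing s x) ->
    (forall x, A x -> 1 <= s x) -> forall x, 1 <= s x.

Definition non_thick b A : Prop := ~ thick b A.

Definition supported_in A f : Prop := forall x, ~ A x -> f x = 0.

Definition decomposition c c1 c2 : Prop :=
  [/\ forall x, c x = c1 x + c2 x, forall x, 0 <= c1 x & forall x, 0 <= c2 x].

(* For [u] with values in [0, +oo]. *)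
Definition bounded_above (u : X -> \bar R) : Prop :=
  exists M : R, forall x, (u x <= M%:E)%E.

Definition finite_everywhere (u : X -> \bar R) : Prop :=
  forall x, (u x < +oo)%E.

End Graphs.

(* Main.v *)
Require Import Defs.
From HB Require Import structures.
From mathcomp Require Import all_boot all_order all_algebra.
From mathcomp Require Import all_classical all_reals all_analysis.
From mathcomp Require Import ring lra.

(* The Green functions are built without finite Dirichlet problems: iterating
   u(x) := (1_y(x) + sum_z b(x,z) u(z)) / (deg(x) + c(x)) along an exhaustion by
   finite sets gives an increasing sequence u_n of finitely supported functions
   lying below every nonnegative supersolution of L u = 1_y. Since L u_n <= 1_y
   on the support of u_n, the energy of u_n is at most u_n(y); for the pointwise
   limit g this gives Q(g) <= g(y), hence Q(g - u_n) <= g(y) - u_n(y), which puts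
   g in D_0. The sequence is bounded as soon as point evaluations are bounded in
   energy, and that property is equivalent to transience. Consequently
   G f is the smallest nonnegative w with L w >= f.
   This minimality gives both directions.
   If v := Gc is not 1, then v < 1/2 somewhere, since otherwise 2v - 1 would be a
   supersolution for c, so 2v - 1 >= v. With A := {v >= 1/2}, the
   function 2v shows that A is not thick, and it is a (b,0)-supersolution for
   1_{X\A} c, so that G^b(1_{X\A} c) <= 2v <= 2.
   Conversely, let Gc = 1, let v := G^b(1_{X\A} c) be finite, and let s >= 0 be
   superharmonic with s >= 1 on A. Then min(s + v, 1) is a (b,c)-supersolution for
   c, so s + v >= Gc = 1; hence s + v - 1 is a (b,0)-supersolution for 1_{X\A} c,
   so s + v - 1 >= v and s >= 1: A is thick.
   If (b,0) is not transient, nonnegative superharmonic functions are constant. *)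

Set Implicit Arguments.
Unset Strict Implicit.
Unset Printing Implicit Defensive.

Import Order.TTheory GRing.Theory Num.Theory.
Import numFieldNormedType.Exports.
Local Open Scope classical_set_scope.
Local Open Scope ring_scope.

(** * Sums over countable sets *)

Lemma ler_sum_subset (R : realType) (T : eqType) (s t : seq T) (F : T -> R) :
  uniq s -> uniq t -> {subset s <= t} -> (forall x, 0 <= F x) ->
  \sum_(x <- s) F x <= \sum_(x <- t) F x.
Proof.
move=> us ut st F0; rewrite [leRHS](bigID (mem s))/= -[X in _ <= X + _]big_filter.
have st_perm : perm_eq s [seq x <- t | x \in s].
  rewrite uniq_perm ?filter_uniq// => x.
  by rewrite mem_filter andb_idr//; exact: st.
by rewrite -(perm_big _ st_perm) lerDl sumr_ge0.
Qed.

Section Sums.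
Context {R : realType} {T : choiceType}.
Implicit Types (a f g p q : T -> R) (s : seq T).

Lemma sum_seq_le_esum s (a : T -> \bar R) : uniq s -> (forall x, 0 <= a x)%E ->
  (\sum_(x <- s) a x <= \esum_(x in setT) a x)%E.
Proof.
move=> us a0; apply: esum_ge; exists [set` s]; first by split=> //; exact: finite_seq.
rewrite fsbig_finite; last exact: finite_seq.
rewrite [leRHS](perm_big s)//=.
apply: uniq_perm; [exact: finmap.fset_uniq|by []|].
move=> x; rewrite in_fset_set; last exact: finite_seq.
by apply/idP/idP => [/set_mem //|xs]; apply/mem_set.
Qed.

Lemma esum_le_seq (a : T -> \bar R) (M : \bar R) :
  (forall s, uniq s -> (\sum_(x <- s) a x <= M)%E) ->
  (\esum_(x in setT) a x <= M)%E.
Proof.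
move=> h; apply: ge_ereal_sup => _ [A [finA _] <-].
by rewrite fsbig_finite//; apply: h; exact: finmap.fset_uniq.
Qed.

Lemma term_le_esum (a : T -> \bar R) x : (forall x, 0 <= a x)%E ->
  (a x <= \esum_(x in setT) a x)%E.
Proof.
move=> a0; have := @sum_seq_le_esum [:: x] a isT a0.
by rewrite big_seq1.
Qed.

Lemma esumZ (r : R) (a : T -> \bar R) : 0 <= r -> (forall x, 0 <= a x)%E ->
  (\esum_(x in setT) (r%:E * a x) = r%:E * \esum_(x in setT) a x)%E.
Proof.
move=> r0 a0; rewrite /esum -ereal_supZl//; last first.
  apply/set0P; exists 0%E, set0; first by split.
  by rewrite fsbig_set0.
congr ereal_sup; apply/seteqP; split=> [_ [A [fA _] <-]|_ [_ [A [fA _] <-] <-]].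
- exists (\sum_(x \in A) a x)%E; first by exists A.
  by rewrite !fsbig_finite//= ge0_sume_distrr.
- exists A => //.
  by rewrite !fsbig_finite//= ge0_sume_distrr.
Qed.

Lemma esum_exchange (T' : choiceType) (a : T -> T' -> \bar R) :
  (forall x y, 0 <= a x y)%E ->
  (\esum_(x in setT) \esum_(y in setT) a x y =
   \esum_(y in setT) \esum_(x in setT) a x y)%E.
Proof.
move=> a0; rewrite !esum_esum//.
rewrite (@reindex_esum R (T' * T)%type (T * T')%type (setT `*`` fun=> setT) _
  (fun k => (k.2, k.1)))//.
by split=> [[x y]|[x y] [x' y'] _ _ [-> ->]|[x y] _] //=; exists (y, x).
Qed.

Definition abs_summable f := (\esum_(x in setT) `|f x|%:E < +oo)%E.

Lemma abs_summable_le f g : (forall x, `|f x| <= `|g x|) ->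
  abs_summable g -> abs_summable f.
Proof.
by move=> fg; apply: le_lt_trans; apply: le_esum => x _; rewrite lee_fin.
Qed.

Lemma abs_summableD f g : abs_summable f -> abs_summable g ->
  abs_summable (fun x => f x + g x).
Proof.
move=> sf sg; apply: (@le_lt_trans _ _
  (\esum_(x in setT) (`|f x|%:E + `|g x|%:E))%E).
  by apply: le_esum => x _; rewrite -EFinD lee_fin ler_normD.
by rewrite esumD// lte_add_pinfty.
Qed.

Lemma abs_summableZ r f : abs_summable f -> abs_summable (fun x => r * f x).
Proof.
move=> sf; rewrite /abs_summable.
under eq_esum do rewrite normrM EFinM.
rewrite esumZ//.
have : (\esum_(x in setT) `|f x|%:E)%E \is a fin_num.
  by rewrite ge0_fin_numE// esum_ge0.
by move/fineK => <-; rewrite -EFinM ltry.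
Qed.

Lemma abs_summable_seq s f : (forall x, x \notin s -> f x = 0) -> abs_summable f.
Proof.
move=> f0; apply: (@le_lt_trans _ _ (\sum_(x <- undup s) `|f x|)%:E); last exact: ltry.
apply: esum_le_seq => t ut; rewrite sumEFin lee_fin.
rewrite (bigID (mem s))/= [X in _ + X]big1 ?addr0; last first.
  by move=> x xs; rewrite f0 ?normr0.
rewrite -big_filter ler_sum_subset ?filter_uniq ?undup_uniq// => x.
by rewrite mem_filter mem_undup => /andP[].
Qed.

Lemma abs_summable_ge0 f : (forall x, 0 <= f x) ->
  abs_summable f <-> (\esum_(x in setT) (f x)%:E < +oo)%E.
Proof.
move=> f0; rewrite /abs_summable.
by under eq_esum do rewrite ger0_norm//.
Qed.

Lemma abs_summable_fin f : (forall x, 0 <= f x) -> abs_summable f ->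
  (\esum_(x in setT) (f x)%:E)%E \is a fin_num.
Proof.
move=> f0 /(abs_summable_ge0 f0) sf.
by rewrite ge0_fin_numE// esum_ge0// => x _; rewrite lee_fin.
Qed.

(** The functions [p] and [q] need not be the positive and negative parts of their difference. This
    freedom gives the additivity of [signed_sum]. *)
Lemma signed_sumB (X : countType) (p q : X -> R) :
  (forall x, 0 <= p x) -> (forall x, 0 <= q x) ->
  (\esum_(x in setT) (p x)%:E < +oo)%E -> (\esum_(x in setT) (q x)%:E < +oo)%E ->
  signed_sum (fun x => p x - q x) =
  fine (\esum_(x in setT) (p x)%:E)%E - fine (\esum_(x in setT) (q x)%:E)%E.
Proof.
move=> p0 q0 sp sq.
rewrite /signed_sum -fineB; last 2 first.
- by rewrite ge0_fin_numE ?esum_ge0// => x _; rewrite lee_fin.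
- by rewrite ge0_fin_numE ?esum_ge0// => x _; rewrite lee_fin.
congr fine.
have sp' : summable setT (EFin \o p).
  by rewrite /summable; under eq_esum do rewrite /= ger0_norm//.
have sq' : summable setT (EFin \o q).
  by rewrite /summable; under eq_esum do rewrite /= ger0_norm//.
rewrite -(esumB sp' sq')//=; [|by move=> i _; rewrite lee_fin..].
congr (_ - _)%E; apply: eq_esum => x _.
- by rewrite funeposE /= EFin_max.
- by rewrite funenegE /= EFin_max.
Qed.

End Sums.

(** * Linearity of [signed_sum] on absolutely summable functions *)

Section SignedSum.
Context {R : realType} {X : countType}.
Implicit Types (f g : X -> R) (s : seq X).

Lemma abs_summable_funrpos f : abs_summable f -> abs_summable f^\+.
Proof.
apply: abs_summable_le => x; rewrite ger0_norm ?funrpos_ge0// /funrpos.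
by rewrite ge_max ler_norm normr_ge0.
Qed.

Lemma abs_summable_funrneg f : abs_summable f -> abs_summable f^\-.
Proof.
apply: abs_summable_le => x; rewrite ger0_norm ?funrneg_ge0// /funrneg.
by rewrite ge_max -normrN ler_norm normr_ge0.
Qed.

Lemma signed_sum_ge0 f : (forall x, 0 <= f x) ->
  signed_sum f = fine (\esum_(x in setT) (f x)%:E)%E.
Proof.
move=> f0; rewrite /signed_sum [X in (_ - X)%E]esum1 ?sube0.
  by congr fine; apply: eq_esum => x _; rewrite (@ge0_funrposE _ _ setT)// inE.
by move=> x _; rewrite (@ge0_funrnegE _ _ setT)// inE.
Qed.

Lemma signed_sumD f g : abs_summable f -> abs_summable g ->
  signed_sum (fun x => f x + g x) = signed_sum f + signed_sum g.
Proof.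
move=> sf sg.
have fin (h : X -> R) : abs_summable h ->
    [/\ (\esum_(x in setT) (h^\+ x)%:E)%E \is a fin_num,
     (\esum_(x in setT) (h^\- x)%:E)%E \is a fin_num &
     signed_sum h = fine (\esum_(x in setT) (h^\+ x)%:E)%E -
       fine (\esum_(x in setT) (h^\- x)%:E)%E].
  move=> sh.
  have hp : (\esum_(x in setT) (h^\+ x)%:E)%E \is a fin_num.
    exact: (abs_summable_fin (funrpos_ge0 h) (abs_summable_funrpos sh)).
  have hn : (\esum_(x in setT) (h^\- x)%:E)%E \is a fin_num.
    exact: (abs_summable_fin (funrneg_ge0 h) (abs_summable_funrneg sh)).
  by split => //; rewrite /signed_sum fineB.
have [fp fn ->] := fin _ sf.
have [gp gn ->] := fin _ sg.
rewrite (_ : (fun x => f x + g x) =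
    (fun x => (f^\+ x + g^\+ x) - (f^\- x + g^\- x))); last first.
  apply/funext => x; rewrite -[in LHS](funrposBneg f) -[in LHS](funrposBneg g).
  by rewrite !fctE; ring.
have esD (p q : X -> R) : (forall x, 0 <= p x) -> (forall x, 0 <= q x) ->
    (\esum_(x in setT) (p x + q x)%:E =
     \esum_(x in setT) (p x)%:E + \esum_(x in setT) (q x)%:E)%E.
  move=> p0 q0; rewrite -esumD// => x _; rewrite lee_fin//.
have fp0 := funrpos_ge0 f; have gp0 := funrpos_ge0 g.
have fn0 := funrneg_ge0 f; have gn0 := funrneg_ge0 g.
rewrite signed_sumB ?esD//.
- by rewrite !fineD//; ring.
- by move=> x; rewrite addr_ge0.
- by move=> x; rewrite addr_ge0.
- by rewrite -ge0_fin_numE ?fin_numD ?fp// adde_ge0// esum_ge0// => x _; rewrite lee_fin.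
- by rewrite -ge0_fin_numE ?fin_numD ?fn// adde_ge0// esum_ge0// => x _; rewrite lee_fin.
Qed.

Lemma signed_sum0 : signed_sum (fun _ : X => 0 : R) = 0.
Proof. by rewrite signed_sum_ge0// esum1. Qed.

Lemma signed_sumN f : abs_summable f ->
  signed_sum (fun x => - f x) = - signed_sum f.
Proof.
move=> sf; apply/eqP; rewrite -addr_eq0 addrC -signed_sumD//.
  by under eq_fun do rewrite subrr; rewrite signed_sum0.
by under eq_fun do rewrite -mulN1r; exact: abs_summableZ.
Qed.

Lemma signed_sumZ r f : abs_summable f ->
  signed_sum (fun x => r * f x) = r * signed_sum f.
Proof.
have pos p (g : X -> R) : 0 <= p -> (forall x, 0 <= g x) -> abs_summable g ->
    signed_sum (fun x => p * g x) = p * signed_sum g.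
  move=> p0 g0 sg; rewrite !signed_sum_ge0//; last by move=> x; rewrite mulr_ge0.
  under eq_esum do rewrite EFinM.
  rewrite esumZ//.
  by rewrite fineM// abs_summable_fin.
have nonneg p (g : X -> R) : 0 <= p -> abs_summable g ->
    signed_sum (fun x => p * g x) = p * signed_sum g.
  move=> p0 sg.
  have gE : g = fun x => g^\+ x + - g^\- x by rewrite -[LHS]funrposBneg.
  have sgp := abs_summable_funrpos sg; have sgn := abs_summable_funrneg sg.
  have sN h : abs_summable h -> abs_summable (fun x : X => - h x).
    by move=> sh; under eq_fun do rewrite -mulN1r; exact: abs_summableZ.
  rewrite [in RHS]gE signed_sumD//; last exact: sN.
  rewrite signed_sumN// mulrDr mulrN -!pos//.
  rewrite -signed_sumN; last exact: abs_summableZ.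
  rewrite -signed_sumD; [|exact: abs_summableZ|by apply: sN; exact: abs_summableZ].
  congr signed_sum; apply/funext => x; rewrite {1}gE; ring.
move=> sf; have [r0|r0] := leP 0 r; first exact: nonneg.
rewrite -[r]opprK mulNr -nonneg// ?oppr_ge0 1?ltW//.
rewrite -signed_sumN; last exact: abs_summableZ.
by congr signed_sum; apply/funext => x; ring.
Qed.

Lemma signed_sum_seq s f : uniq s -> (forall x, x \notin s -> f x = 0) ->
  signed_sum f = \sum_(x <- s) f x.
Proof.
elim: s f => [|z s IH] f /=.
  move=> _ f0; rewrite big_nil (_ : f = fun=> 0) ?signed_sum0//.
  by apply/funext => x; exact: f0.
move=> /andP[zs us] f0; rewrite big_cons.
pose d := fun x => if x == z then f z else 0.
pose g := fun x => if x == z then 0 else f x.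
have fE : f = fun x => d x + g x.
  by apply/funext => x; rewrite /d /g; case: eqP => [->|]; rewrite ?addr0 ?add0r.
have g0 x : x \notin s -> g x = 0.
  by rewrite /g; case: eqP => // xz xs; rewrite f0// inE (introF eqP xz).
have sgE : \sum_(x <- s) g x = \sum_(x <- s) f x.
  apply: eq_big_seq => x xs; rewrite /g; case: eqP => // xz.
  by rewrite -xz xs in zs.
have sd x : x \notin [:: z] -> d x = 0 by rewrite inE /d => /negPf ->.
have dE : signed_sum d = f z.
  pose e (x : X) : R := (x == z)%:R.
  have -> : d = fun x => f z * e x.
    by apply/funext => x; rewrite /d /e; case: eqP; rewrite ?mulr1 ?mulr0.
  have e0 x : 0 <= e x by rewrite /e ler0n.
  rewrite signed_sumZ; last first.
    by apply: (@abs_summable_seq _ _ [:: z]) => x; rewrite inE /e => /negPf ->.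
  rewrite signed_sum_ge0// (_ : (\esum_(x in setT) (e x)%:E)%E = 1%E) ?mulr1//.
  transitivity (\esum_(x in [set z]) (1%:E : \bar R))%E; last by rewrite esum_set1.
  rewrite [RHS]esum_mkcond; apply: eq_esum => x _; rewrite /e.
  by case: eqP => [->|xz]; [rewrite mem_set|rewrite memNset].
rewrite {1}fE signed_sumD; [|exact: abs_summable_seq sd|exact: abs_summable_seq g0].
by rewrite dE IH// sgE.
Qed.

End SignedSum.

(** * Energy and Laplacian *)

Section Energy.
Context {R : realType} {X : countType} (b : X -> X -> R) (c : X -> R).
Hypothesis graph_bc : is_graph b c.
Implicit Types (f g phi : X -> R) (s : seq X).

Let b0 x y : 0 <= b x y := graph_edge_ge0 graph_bc x y.
Let bC x y : b x y = b y x := graph_edge_sym graph_bc x y.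
Let bxx x : b x x = 0 := graph_edge_diag graph_bc x.
Let c0 x : 0 <= c x := graph_kill_ge0 graph_bc x.

(** The diagonal coefficient of the operator: where the sums converge, [laplacian b c f x] is
    [weight x * f x] minus the sum of [b x y * f y]. *)
Definition weight (x : X) : R := fine (\esum_(y in setT) (b x y)%:E)%E + c x.

Lemma abs_summable_edge x : abs_summable (b x).
Proof. by apply/abs_summable_ge0 => //; exact: graph_edge_sum graph_bc x. Qed.

Lemma edge_sumE x : signed_sum (b x) = weight x - c x.
Proof. by rewrite signed_sum_ge0// /weight addrK. Qed.

Lemma energy_terms_ge0 f :
  (forall p : X * X, 0 <= b p.1 p.2 * (f p.1 - f p.2) ^+ 2) /\
  (forall x, 0 <= c x * f x ^+ 2).
Proof. by split=> ?; rewrite mulr_ge0// sqr_ge0. Qed.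

Lemma energy_ge0 f : (0 <= energy b c f)%E.
Proof.
have [h1 h2] := energy_terms_ge0 f.
by rewrite adde_ge0// ?mule_ge0 ?lee_fin ?invr_ge0// esum_ge0// => ? _; rewrite lee_fin.
Qed.

(** Isolates what depends on the value at [z]. Each edge at [z] occurs in both orders in the sum
    over pairs, which cancels the factor 1/2; the pair (z, z) has weight 0. *)
Lemma energy_split z f : energy b c f =
  ((2^-1)%:E * (\esum_(p in [set p : X * X | p.1 <> z /\ p.2 <> z])
       (b p.1 p.2 * (f p.1 - f p.2) ^+ 2)%:E) +
   \esum_(x in [set x | x <> z]) (c x * f x ^+ 2)%:E +
   (\esum_(y in setT) (b z y * (f z - f y) ^+ 2)%:E + (c z * f z ^+ 2)%:E))%E.
Proof.
have [h1 h2] := energy_terms_ge0 f.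
rewrite /energy.
rewrite (@esumID _ _ [set z] setT (fun x => (c x * f x ^+ 2)%:E))//; last first.
  by move=> x _; rewrite lee_fin.
rewrite !setTI esum_set1 ?lee_fin//.
rewrite (_ : ~` [set z] = [set x | x <> z])//.
rewrite (@esumID _ _ [set p : X * X | p.1 = z] setT)//; last first.
  by move=> p _; rewrite lee_fin.
rewrite !setTI.
rewrite (@esumID _ _ [set p : X * X | p.2 = z] (~` _))//; last first.
  by move=> p _; rewrite lee_fin.
set L := (\esum_(y in setT) (b z y * (f z - f y) ^+ 2)%:E)%E.
have L0 : (0 <= L)%E.
  by rewrite esum_ge0// => x _; rewrite lee_fin mulr_ge0// sqr_ge0.
rewrite (_ : (\esum_(i in [set p | p.1 = z]) _)%E = L); last first.
  rewrite (@reindex_esum _ _ _ setT _ (fun y => (z, y)))//.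
  split=> [y _|y y' _ _ [//]|[x y] /= ->] //; first by exists y.
rewrite (_ : (\esum_(i in ~` [set p | p.1 = z] `&` [set p | p.2 = z]) _)%E = L); last first.
  rewrite (@reindex_esum _ _ _ [set x | x <> z] _ (fun y => (y, z)))//; last first.
    by split=> [y /= yz|y y' _ _ [//]|[x y] /= [xz ->]] //; exists x.
  rewrite /= esum_mkcond; apply: eq_esum => x _.
  have [->|xz] := eqVneq x z; first by rewrite bxx mul0r; case: ifP.
  rewrite mem_set; last exact/eqP.
  by rewrite /= (bC x z) -sqrrN opprB.
rewrite (_ : ~` _ `&` ~` _ = [set p : X * X | p.1 <> z /\ p.2 <> z])//.
set P := esum _ _.
have P0 : (0 <= P)%E by rewrite esum_ge0// => x _; rewrite lee_fin.
have -> : ((2^-1)%:E * (L + (L + P)) = L + (2^-1)%:E * P)%E.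
  rewrite addeA muleDr ?ge0_adde_def ?inE ?adde_ge0//; congr (_ + _)%E.
  rewrite muleDr ?ge0_adde_def ?inE// -ge0_muleDl ?lee_fin ?invr_ge0//.
  by rewrite -EFinD (_ : 2^-1 + 2^-1 = 1 :> R) ?mul1e//; field.
set C := (c z * _)%:E; set S := esum _ _; set H := (_ * P)%E.
by rewrite addeACA addeC.
Qed.

Lemma finite_energy_local f z : finite_energy b c f ->
  abs_summable (fun y => b z y * (f z - f y) ^+ 2).
Proof.
move=> Ef; apply/abs_summable_ge0; first by move=> y; rewrite mulr_ge0// sqr_ge0.
have [h1 h2] := energy_terms_ge0 f.
apply: le_lt_trans Ef; rewrite (energy_split z).
rewrite [leRHS]addeC -addeA leeDl// !adde_ge0 ?lee_fin//.
  by rewrite mule_ge0 ?lee_fin ?invr_ge0// esum_ge0// => p _; rewrite lee_fin.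
by rewrite esum_ge0// => p _; rewrite lee_fin.
Qed.

(** By |t| <= 1 + t^2 and the summability of the edge weights. Hence [laplacian] is meaningful on
    all functions of finite energy. *)
Lemma finite_energy_diff f z : finite_energy b c f ->
  abs_summable (fun y => b z y * (f z - f y)).
Proof.
move=> /(finite_energy_local z) sf.
apply: abs_summable_le (abs_summableD (abs_summable_edge z) sf) => y.
rewrite [leRHS]ger0_norm; last by rewrite addr_ge0// mulr_ge0// sqr_ge0.
rewrite normrM (ger0_norm (b0 _ _)) -{2}[b z y]mulr1 -mulrDr ler_wpM2l//.
set t := f z - f y; rewrite -(real_normK (num_real t)).
have := normr_ge0 t; set a := `|t|; nra.
Qed.

Definition delta (z : X) (a : R) (x : X) : R := if x == z then a else 0.

(** Only the terms isolated by [energy_split] change; expanding their squares produces the Laplacian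
    at [z] and the weight. *)
Lemma energy_add_delta f z a : finite_energy b c f ->
  energy b c (fun x => f x + delta z a x) =
  (energy b c f + (2 * a * laplacian b c f z + a ^+ 2 * weight z)%:E)%E.
Proof.
move=> Ef.
have [h1 h2] := energy_terms_ge0 f.
have sf := finite_energy_diff z Ef; have s2 := finite_energy_local z Ef.
have sE := abs_summable_edge z.
have dz x : x <> z -> delta z a x = 0 by rewrite /delta; case: eqP.
have dzz : delta z a z = a by rewrite /delta eqxx.
rewrite (energy_split z f) [LHS](energy_split z) -[RHS]addeA; congr (_ + _)%E.
  congr (_ * _ + _)%E; apply: eq_esum => p /=.
    by move=> [p1 p2]; rewrite !dz// !addr0.
  by move=> pz; rewrite dz// addr0.
rewrite dzz.
have fL : (\esum_(y in setT) (b z y * (f z - f y) ^+ 2)%:E)%E =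
    (signed_sum (fun y => b z y * (f z - f y) ^+ 2))%:E.
  rewrite signed_sum_ge0 ?fineK//; last by move=> y; rewrite mulr_ge0// sqr_ge0.
  by apply: abs_summable_fin => // y; rewrite mulr_ge0// sqr_ge0.
have -> : (\esum_(y in setT) (b z y * (f z + a - (f y + delta z a y)) ^+ 2)%:E)%E =
    (signed_sum (fun y => b z y * (f z - f y) ^+ 2 +
       (2 * a * (b z y * (f z - f y)) + a ^+ 2 * b z y)))%:E.
  have E y : b z y * (f z - f y) ^+ 2 +
       (2 * a * (b z y * (f z - f y)) + a ^+ 2 * b z y) =
      b z y * (f z + a - (f y + delta z a y)) ^+ 2.
    have [->|/eqP yz] := eqVneq y z; first by rewrite bxx; ring.
    by rewrite dz//; ring.
  rewrite (eq_fun E) signed_sum_ge0; last by move=> y; rewrite mulr_ge0// sqr_ge0.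
  rewrite fineK//; apply: abs_summable_fin.
    by move=> y; rewrite mulr_ge0// sqr_ge0.
  rewrite -(eq_fun E); apply: abs_summableD => //.
  by apply: abs_summableD; exact: abs_summableZ.
rewrite fL -!EFinD; congr EFin.
rewrite signed_sumD//; last by apply: abs_summableD; exact: abs_summableZ.
rewrite signed_sumD; [|exact: abs_summableZ..].
rewrite !signed_sumZ// edge_sumE /laplacian; ring.
Qed.

Lemma laplacianD f g x :
  abs_summable (fun y => b x y * (f x - f y)) ->
  abs_summable (fun y => b x y * (g x - g y)) ->
  laplacian b c (fun x => f x + g x) x = laplacian b c f x + laplacian b c g x.
Proof.
move=> sf sg; rewrite /laplacian mulrDr addrACA -signed_sumD//.
by congr (signed_sum _ + _); apply/funext => y; ring.
Qed.

Lemma laplacianN f x :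
  abs_summable (fun y => b x y * (f x - f y)) ->
  laplacian b c (fun x => - f x) x = - laplacian b c f x.
Proof.
move=> sf; rewrite /laplacian mulrN opprD -signed_sumN//.
by congr (signed_sum _ + _); apply/funext => y; ring.
Qed.

Lemma abs_summable_diff_seq s phi x : (forall x, x \notin s -> phi x = 0) ->
  abs_summable (fun y => b x y * (phi x - phi y)).
Proof.
move=> p0; have -> : (fun y => b x y * (phi x - phi y)) =
   (fun y => phi x * b x y + - 1 * (b x y * phi y)).
  by apply/funext => y; ring.
apply: abs_summableD; apply: abs_summableZ; first exact: abs_summable_edge.
by apply: (@abs_summable_seq _ _ s) => y /p0 ->; rewrite mulr0.
Qed.

Lemma laplacian_seq s phi x : uniq s -> (forall x, x \notin s -> phi x = 0) ->
  laplacian b c phi x = weight x * phi x - \sum_(y <- s) b x y * phi y.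
Proof.
move=> us p0; rewrite /laplacian.
have -> : (fun y => b x y * (phi x - phi y)) =
   (fun y => phi x * b x y + - (b x y * phi y)).
  by apply/funext => y; ring.
have s2 : abs_summable (fun y => b x y * phi y).
  by apply: (@abs_summable_seq _ _ s) => y /p0 ->; rewrite mulr0.
rewrite signed_sumD ?signed_sumN//; last 2 first.
- exact/abs_summableZ/abs_summable_edge.
- by under eq_fun do rewrite -mulN1r; exact: abs_summableZ.
rewrite signed_sumZ; last exact: abs_summable_edge.
rewrite edge_sumE (@signed_sum_seq _ _ s)//; last first.
  by move=> y /p0 ->; rewrite mulr0.
ring.
Qed.

(** Green's formula for a finitely supported perturbation: the sum is twice the mixed form plus the
    energy of [phi]. The support is built up one vertex at a time by [energy_add_delta]. *)
Lemma energy_add_seq f s phi : uniq s -> (forall x, x \notin s -> phi x = 0) ->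
  finite_energy b c f ->
  energy b c (fun x => f x + phi x) =
  (energy b c f + (\sum_(x <- s)
     phi x * (2 * laplacian b c f x + laplacian b c phi x))%:E)%E.
Proof.
move=> + + Ef; elim: s phi => [|z s IH] phi.
  move=> _ p0; rewrite big_nil adde0; congr energy.
  by apply/funext => x; rewrite p0 ?addr0.
move=> /= /andP[zs us] p0.
pose psi x := if x == z then 0 else phi x.
have psi0 x : x \notin s -> psi x = 0.
  by rewrite /psi; case: eqP => // /eqP xz xs; rewrite p0// inE negb_or xz.
have phiE x : phi x = psi x + delta z (phi z) x.
  by rewrite /psi /delta; case: eqP => [->|]; rewrite ?add0r ?addr0.
have psiz : psi z = 0 by rewrite /psi eqxx.
have delta0 x : x \notin [:: z] -> delta z (phi z) x = 0.
  by rewrite inE /delta => /negPf ->.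
have Epsi : finite_energy b c (fun x => f x + psi x).
  rewrite /finite_energy/= IH// -[energy _ _ _]fineK ?ge0_fin_numE ?energy_ge0//.
  by rewrite -EFinD ltry.
rewrite (_ : (fun x => f x + phi x) = fun x => (f x + psi x) + delta z (phi z) x); last first.
  by apply/funext => x; rewrite -addrA -phiE.
rewrite energy_add_delta// IH// -addeA -EFinD; congr (_ + _%:E)%E.
have spsi x := abs_summable_diff_seq x psi0.
have sdel x := abs_summable_diff_seq x delta0.
have sf x := finite_energy_diff x Ef.
have lapphi x : laplacian b c phi x =
    laplacian b c psi x + (weight x * delta z (phi z) x - b x z * phi z).
  rewrite [in LHS](_ : phi = fun x => psi x + delta z (phi z) x); last by apply/funext.
  rewrite laplacianD// (@laplacian_seq [:: z] (delta z (phi z)))// big_seq1.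
  by rewrite /delta eqxx.
rewrite laplacianD// big_cons lapphi bxx /delta eqxx.
(* By the symmetry of [b], the change of the Laplacian on [s] caused by [phi z], weighted with
   [psi], equals [phi z] times the Laplacian of [psi] at [z]. *)
have -> : \sum_(x <- s) phi x * (2 * laplacian b c f x + laplacian b c phi x) =
   \sum_(x <- s) psi x * (2 * laplacian b c f x + laplacian b c psi x) +
   phi z * laplacian b c psi z.
  rewrite [laplacian b c psi z](@laplacian_seq s)// psiz mulr0 sub0r mulrN mulr_sumr.
  rewrite -sumrN -big_split/=; apply: eq_big_seq => x xs.
  have xz : x == z = false by apply/negP => /eqP xz; rewrite -xz xs in zs.
  by rewrite lapphi /delta xz (bC z x) /psi xz; ring.
ring.
Qed.

Lemma energy0 : energy b c (fun=> 0) = 0%E.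
Proof.
rewrite /energy !esum1 ?mule0 ?adde0// => x _; by rewrite ?subr0 expr0n/= mulr0.
Qed.

Lemma energy_seq s phi : uniq s -> (forall x, x \notin s -> phi x = 0) ->
  energy b c phi = (\sum_(x <- s) phi x * laplacian b c phi x)%:E.
Proof.
move=> us p0.
have E0 : finite_energy b c (fun=> 0) by rewrite /finite_energy/= energy0 ltry.
have := energy_add_seq us p0 E0; rewrite energy0 add0e.
under eq_fun do rewrite add0r; move=> ->; congr EFin; apply: eq_bigr => x _.
rewrite (@laplacian_seq [::] (fun=> 0))// big_nil mulr0 subr0 mulr0 add0r//.
Qed.

End Energy.

(** * Approximation of Green functions *)

Section Exhaustion.
Context {X : countType}.

Definition exhaust n : seq X := pmap pickle_inv (iota 0 n).

Lemma exhaust_uniq n : uniq (exhaust n).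
Proof. exact: (pmap_uniq pickle_invK (iota_uniq 0 n)). Qed.

Lemma mem_exhaust n x : (x \in exhaust n) = (pickle x < n)%N.
Proof.
rewrite mem_pmap; apply/mapP/idP => [[k]|kn].
  rewrite mem_iota add0n => /= kn kx.
  by have := @pickle_invK X k; rewrite -kx /= => ->.
by exists (pickle x); rewrite ?mem_iota// pickleK_inv.
Qed.

Lemma exhaust_near (s : seq X) : \forall n \near \oo, {subset s <= exhaust n}.
Proof.
elim: s => [|z s IH]; first exact: nearW.
apply: filterS2 IH (nbhs_infty_gt (pickle z)) => n sn zn x.
by rewrite inE => /predU1P[->|/sn//]; rewrite mem_exhaust.
Qed.

Lemma sum_exhaust_le (R : realType) n (F F' : X -> R) :
  (forall x, 0 <= F x) -> (forall x, F x <= F' x) ->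
  \sum_(x <- exhaust n) F x <= \sum_(x <- exhaust n.+1) F' x.
Proof.
move=> F0 FF'; rewrite {2}/exhaust -addn1 iotaD pmap_cat big_cat/= -/(exhaust n).
rewrite -[leLHS]addr0 lerD ?ler_sum// sumr_ge0// => x _.
exact: le_trans (F0 x) (FF' x).
Qed.

End Exhaustion.

Lemma cvg_sum_seq (R : realType) (T : Type) (s : seq T) (a_ : nat -> T -> R) (a : T -> R) :
  (forall x, a_ n x @[n --> \oo] --> a x) ->
  \sum_(x <- s) a_ n x @[n --> \oo] --> \sum_(x <- s) a x.
Proof.
move=> h; elim: s => [|x s IH].
  by under eq_cvg do rewrite big_nil; rewrite big_nil; exact: cvg_cst.
under eq_cvg do rewrite big_cons.
by rewrite big_cons; apply: cvgD.
Qed.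

Lemma sum_seq_lim_le (R : realType) (T : Type) (s : seq T) (a_ : nat -> T -> R)
    (a : T -> R) (M : R) :
  (forall x, a_ n x @[n --> \oo] --> a x) ->
  (\forall n \near \oo, \sum_(x <- s) a_ n x <= M) ->
  \sum_(x <- s) a x <= M.
Proof. by move=> h; apply: cvgr_to_le; exact: cvg_sum_seq. Qed.

Lemma sum_pole (R : realType) (T : eqType) (s : seq T) (phi : T -> R) y : uniq s ->
  (forall x, x \notin s -> phi x = 0) -> \sum_(x <- s) phi x * (x == y)%:R = phi y.
Proof.
move=> us p0; have [ys|ys] := boolP (y \in s).
  rewrite (bigD1_seq y)//= eqxx mulr1 big1 ?addr0// => x /negPf ->.
  by rewrite mulr0.
rewrite p0// big_seq big1// => x xs; case: eqP => [xy|]; rewrite ?mulr0//.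
by rewrite xy (negPf ys) in xs.
Qed.

Section Approximation.
Context {R : realType} {X : countType} (b : X -> X -> R) (c : X -> R).
Hypothesis graph_bc : is_graph b c.
Implicit Types (f g w phi : X -> R) (s : seq X).

Local Notation W := (weight b c).
Let b0 x y : 0 <= b x y := graph_edge_ge0 graph_bc x y.
Let c0 x : 0 <= c x := graph_kill_ge0 graph_bc x.

Lemma weight_ge0 x : 0 <= W x.
Proof. by rewrite addr_ge0// fine_ge0// esum_ge0// => y _; rewrite lee_fin. Qed.

(** This is L w >= f with the neighbour sum moved to the left, so that no subtraction occurs. As the
    right side is finite, it also puts [w] into the formal domain. *)
Definition supersolution f w :=
  (forall x, 0 <= w x) /\
  forall x, ((f x)%:E + \esum_(z in setT) (b x z * w z)%:E <= (W x * w x)%:E)%E.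

Lemma supersolution_seq f w s x : supersolution f w -> uniq s ->
  f x + \sum_(z <- s) b x z * w z <= W x * w x.
Proof.
move=> [w0 /(_ x) fw] us; rewrite -lee_fin; apply: le_trans fw.
rewrite EFinD leeD2l// -sumEFin; apply: sum_seq_le_esum => // z.
by rewrite lee_fin mulr_ge0.
Qed.

(* Summing over [exhaust m] only, instead of over X, keeps the support finite. *)
Fixpoint green_approx y n x : R :=
  if n is m.+1 then
    if x \in exhaust m.+1 then
      ((x == y)%:R + \sum_(z <- exhaust m) b x z * green_approx y m z) / W x
    else 0
  else 0.

Lemma green_approx_ge0 y n x : 0 <= green_approx y n x.
Proof.
elim: n x => [//|n IH] x /=; case: ifP => // _.
by rewrite divr_ge0 ?weight_ge0// addr_ge0// sumr_ge0// => z _; rewrite mulr_ge0.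
Qed.

Lemma green_approx_supp y n x : x \notin exhaust n -> green_approx y n x = 0.
Proof. by case: n => //= n /negPf ->. Qed.

Lemma green_approxS y n x : green_approx y n x <= green_approx y n.+1 x.
Proof.
elim: n x => [|n IH] x; first exact: green_approx_ge0.
rewrite [leLHS]/=; case: ifP => xn; last exact: green_approx_ge0.
rewrite [leRHS]/= [x \in _]mem_exhaust ltnS ltnW; last by rewrite -mem_exhaust.
rewrite ler_wpM2r ?invr_ge0 ?weight_ge0// lerD2l; apply: sum_exhaust_le => z.
  by rewrite mulr_ge0 ?green_approx_ge0.
by rewrite ler_wpM2l.
Qed.

Lemma green_approx_homo y x :
  {homo (fun n => green_approx y n x) : n m / (n <= m)%N >-> n <= m}.
Proof. by apply/nondecreasing_seqP => n; exact: green_approxS. Qed.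

(** One step of the iteration preserves the bound, since [w] satisfies the corresponding inequality.
    A whole combination of poles is treated at once, so that the bound passes to Green operators. *)
Lemma green_approx_le f w s n x : (forall x, 0 <= f x) -> supersolution f w ->
  uniq s -> (forall x, 0 < W x) -> \sum_(y <- s) f y * green_approx y n x <= w x.
Proof.
move=> f0 sw us W0; have w0 x := proj1 sw x; elim: n x => [|n IH] x.
  by rewrite big1 => [|y _]; rewrite ?mulr0.
have [xn|xn] := boolP (x \in exhaust n.+1); last first.
  by rewrite big1 => [|y _]; rewrite ?green_approx_supp ?mulr0.
rewrite /= xn.
under eq_bigr do rewrite mulrA mulrDr.
rewrite -mulr_suml ler_pdivrMr// big_split/= mulrC.
apply: le_trans (supersolution_seq x sw (exhaust_uniq n)).
rewrite lerD//.
  have [xs|xs] := boolP (x \in s).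
    rewrite (bigD1_seq x)//= eqxx mulr1 big1 ?addr0// => y /negPf.
    by rewrite eq_sym => ->; rewrite mulr0.
  rewrite big_seq big1// => y ys; case: eqP => [xy|]; rewrite ?mulr0//.
  by rewrite xy ys in xs.
under eq_bigr do rewrite mulr_sumr.
rewrite exchange_big/= ler_sum// => z _.
under eq_bigr do rewrite mulrCA.
by rewrite -mulr_sumr ler_wpM2l.
Qed.

Lemma green_approx_pole_le a y w n x : 0 < a ->
  supersolution (fun x => a * (x == y)%:R) w ->
  (forall x, 0 < W x) -> green_approx y n x <= w x / a.
Proof.
move=> a0 sw W0; rewrite ler_pdivlMr// mulrC.
have := @green_approx_le _ _ [:: y] n x _ sw isT W0.
by rewrite big_seq1 eqxx mulr1; apply => z; rewrite mulr_ge0// ltW.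
Qed.

(** The recursion for stage n uses the values of stage n - 1, which are smaller; replacing them by
    those of stage n turns the equation into an inequality. *)
Lemma laplacian_green_approx_le y n x : (forall x, 0 < W x) -> x \in exhaust n ->
  laplacian b c (green_approx y n) x <= (x == y)%:R.
Proof.
case: n => // n W0 xn.
rewrite (laplacian_seq graph_bc _ (exhaust_uniq n.+1)); last exact: green_approx_supp.
rewrite lerBlDr {1}/green_approx -/green_approx xn mulrC divfK ?gt_eqF//.
rewrite lerD2l; apply: sum_exhaust_le => z; first by rewrite mulr_ge0 ?green_approx_ge0.
by rewrite ler_wpM2l// green_approxS.
Qed.

Lemma energy_green_approx_le y n : (forall x, 0 < W x) ->
  (energy b c (green_approx y n) <= (green_approx y n y)%:E)%E.
Proof.
move=> W0.
rewrite (energy_seq graph_bc (exhaust_uniq n)); last exact: green_approx_supp.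
rewrite lee_fin; apply: (@le_trans _ _
  (\sum_(x <- exhaust n) green_approx y n x * (x == y)%:R)).
  rewrite big_seq [leRHS]big_seq ler_sum// => x xn.
  by rewrite ler_wpM2l ?green_approx_ge0// laplacian_green_approx_le.
by rewrite sum_pole ?exhaust_uniq//; exact: green_approx_supp.
Qed.

(* That is, {y} has positive capacity. *)
Definition bounded_at y := exists2 C : R, 0 < C &
  forall s phi, uniq s -> (forall x, x \notin s -> phi x = 0) ->
    ((phi y ^+ 2)%:E <= C%:E * energy b c phi)%E.

Lemma energy_seq_fin s phi : uniq s -> (forall x, x \notin s -> phi x = 0) ->
  exists2 e : R, energy b c phi = e%:E & 0 <= e.
Proof.
move=> us p0; rewrite (energy_seq graph_bc us p0); eexists; first by [].
by rewrite -lee_fin -(energy_seq graph_bc us p0); exact: energy_ge0.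
Qed.

(** Green's formula makes [f] a reproducing kernel, with mixed form phi(z), and the Cauchy-Schwarz
    inequality bounds phi(z)^2 by the product of the energies. The constant is [e + 1] rather than
    [e] because it has to be positive. *)
Lemma bounded_at_pole f z : finite_energy b c f ->
  (forall x, laplacian b c f x = (x == z)%:R) -> bounded_at z.
Proof.
move=> Ef Lf.
have Ef_fin : energy b c f \is a fin_num by rewrite ge0_fin_numE// energy_ge0.
set e := fine (energy b c f).
have e0 : 0 <= e by rewrite fine_ge0// energy_ge0.
have M0 : 0 < e + 1 by rewrite ltr_wpDl.
exists (e + 1) => // s phi us p0.
have [E EE E0] := energy_seq_fin us p0.
rewrite EE -EFinM lee_fin.
have quad t : 0 <= e + 2 * t * phi z + t ^+ 2 * E.
  have tp0 x : x \notin s -> t * phi x = 0 by move=> /p0 ->; rewrite mulr0.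
  have Lt x : laplacian b c (fun x => t * phi x) x = t * laplacian b c phi x.
    rewrite !(laplacian_seq graph_bc _ us)// mulrBr mulr_sumr mulrCA.
    by congr (_ - _); apply: eq_bigr => y _; rewrite mulrCA.
  have := energy_ge0 graph_bc (fun x => f x + t * phi x).
  rewrite (energy_add_seq graph_bc us tp0 Ef) -[energy b c f]fineK// -EFinD lee_fin -/e.
  move: EE; rewrite (energy_seq graph_bc us p0) => -[EE].
  suff -> : \sum_(x <- s) t * phi x * (2 * laplacian b c f x +
      laplacian b c (fun x0 => t * phi x0) x) = 2 * t * phi z + t ^+ 2 * E.
    by rewrite addrA.
  rewrite -[phi z](sum_pole z us p0) -EE !mulr_sumr -big_split/=.
  apply: eq_bigr => x _; rewrite Lt Lf; ring.
have [->|pz] := eqVneq (phi z) 0; first by rewrite expr0n mulr_ge0// ltW.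
(* With t phi(z) = -(e + 1) the quadratic gives (e + 2) phi(z)^2 <= (e + 1)^2 E, and one factor e +
   1 is then cancelled. *)
have := quad (- (e + 1) / phi z).
have -> : e + 2 * (- (e + 1) / phi z) * phi z + (- (e + 1) / phi z) ^+ 2 * E =
  (e + 1) ^+ 2 * E / phi z ^+ 2 - (e + 2) by field.
rewrite subr_ge0 ler_pdivlMr ?exprn_even_gt0// => h.
have p2 : 0 <= phi z ^+ 2 by rewrite sqr_ge0.
have : (e + 1) * phi z ^+ 2 <= (e + 1) * ((e + 1) * E) by nra.
by rewrite ler_pM2l.
Qed.

(** An edge enters the energy in both orders, which makes up for the factor 1/2. *)
Lemma edge_energy_le f x y :
  ((b x y * (f x - f y) ^+ 2)%:E <= energy b c f)%E.
Proof.
have [h1 h2] := energy_terms_ge0 graph_bc f.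
rewrite (energy_split graph_bc x); apply: (@le_trans _ _
  (\esum_(y in setT) (b x y * (f x - f y) ^+ 2)%:E)%E).
  apply: (@term_le_esum _ _ (fun y => (b x y * (f x - f y) ^+ 2)%:E)) => z.
  by rewrite lee_fin mulr_ge0// sqr_ge0.
rewrite [leRHS]addeC -addeA leeDl// !adde_ge0 ?lee_fin//.
  by rewrite mule_ge0 ?lee_fin ?invr_ge0// esum_ge0// => p _; rewrite lee_fin.
by rewrite esum_ge0// => p _; rewrite lee_fin.
Qed.

(** From phi(y)^2 <= 2 phi(x)^2 + 2 (phi(x) - phi(y))^2, where [edge_energy_le] bounds the last
    square by the energy divided by [b x y]. *)
Lemma bounded_at_edge x y : 0 < b x y -> bounded_at x -> bounded_at y.
Proof.
move=> bxy [C C0 hC]; exists (2 * C + 2 / b x y).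
  by rewrite addr_gt0 ?divr_gt0 ?mulr_gt0.
move=> s phi us p0; have := hC s phi us p0.
have := edge_energy_le phi x y.
have [E -> E0] := energy_seq_fin us p0.
rewrite -!EFinM !lee_fin => h1 h2.
have h3 : (phi x - phi y) ^+ 2 <= E / b x y by rewrite ler_pdivlMr// mulrC.
have -> : (2 * C + 2 / b x y) * E = 2 * (C * E) + 2 * (E / b x y) by ring.
have := sqr_ge0 (2 * phi x - phi y); set q := E / b x y in h3 *; set ce := C * E in h2 *; nra.
Qed.

Lemma bounded_at_connected x y : graph_connected b -> bounded_at x -> bounded_at y.
Proof.
move=> /(_ x y)[p [+ <-]]; elim: p x => //= z p IH x /andP[xz zp] bx.
by apply: IH => //; exact: bounded_at_edge bx.
Qed.

(** The indicator of [x] has energy [W x], so [1 <= C * W x]. *)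
Lemma bounded_at_weight x : bounded_at x -> 0 < W x.
Proof.
move=> [C C0 /(_ [:: x] (delta x 1) isT)].
have d0 z : z \notin [:: x] -> delta x (1 : R) z = 0.
  by rewrite inE /delta => /negPf ->.
move=> /(_ d0); rewrite (@energy_seq _ _ _ _ graph_bc [:: x])// big_seq1.
rewrite (@laplacian_seq _ _ _ _ graph_bc [:: x])// big_seq1 (graph_edge_diag graph_bc).
rewrite /delta eqxx expr1n mul0r subr0 mul1r mulr1 -EFinM lee_fin => h.
by have := weight_ge0 x; nra.
Qed.

(** With u_n the approximation, u_n(y)^2 <= C_y Q(u_n) <= C_y u_n(y) gives u_n(y) <= C_y, and then
    u_n(x)^2 <= C_x C_y. The bound 1 + C_x C_y avoids a square root. *)
Lemma green_approx_bounded x y : (forall z, bounded_at z) ->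
  exists M, forall n, green_approx y n x <= M.
Proof.
move=> hb; have W0 z : 0 < W z by exact: bounded_at_weight.
have sq z n : exists2 E : R, 0 <= E <= green_approx y n y &
    forall C, ((green_approx y n z ^+ 2)%:E <= C%:E *
      energy b c (green_approx y n))%E -> green_approx y n z ^+ 2 <= C * E.
  have [E EE E0] := energy_seq_fin (exhaust_uniq n) (@green_approx_supp y n).
  exists E; first by rewrite E0 -lee_fin -EE energy_green_approx_le.
  by move=> C; rewrite EE -EFinM lee_fin.
have [Cy Cy0 hCy] := hb y; have [Cx Cx0 hCx] := hb x.
have yM n : green_approx y n y <= Cy.
  have [E /andP[E0 Ey] /(_ Cy (hCy _ _ (exhaust_uniq n) (@green_approx_supp y n)))] := sq y n.
  have := green_approx_ge0 y n y; move: Ey; set u := green_approx _ _ _ => Ey u0 h.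
  have h' : Cy * E <= Cy * u by rewrite ler_pM2l.
  rewrite leNgt; apply/negP => ?; nra.
exists (1 + Cx * Cy) => n.
have [E /andP[E0 Ey] /(_ Cx (hCx _ _ (exhaust_uniq n) (@green_approx_supp y n)))] := sq x n.
have := yM n => yMn; have := green_approx_ge0 y n x; set u := green_approx y n x => u0 h.
have : u ^+ 2 <= Cx * Cy by apply: le_trans h _; rewrite ler_pM2l// (le_trans Ey).
by move=> ?; nra.
Qed.

End Approximation.

(** Fatou's lemma for sums; the stage from which the bound holds may depend on the finite set. *)
Lemma esum_le_lim (R : realType) (T : choiceType) (a_ : nat -> T -> R) (a : T -> R) (M : R) :
  (forall x, a_ n x @[n --> \oo] --> a x) ->
  (forall s, uniq s -> \forall n \near \oo, \sum_(x <- s) a_ n x <= M) ->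
  (\esum_(x in setT) (a x)%:E <= M%:E)%E.
Proof.
move=> ha hM; apply: esum_le_seq => s us; rewrite sumEFin lee_fin.
exact: sum_seq_lim_le ha (hM s us).
Qed.

(** * The limit of the approximations, its equation and its energy *)

Section Limit.
Context {R : realType} {X : countType} (b : X -> X -> R) (c : X -> R).
Hypothesis graph_bc : is_graph b c.
Implicit Types (f g w phi : X -> R) (s : seq X) (o x y z : X).

Local Notation W := (weight b c).
Let b0 x y : 0 <= b x y := graph_edge_ge0 graph_bc x y.

Lemma esum_laplacian w x : (forall x, 0 <= w x) ->
  (\esum_(z in setT) (b x z * w z)%:E < +oo)%E ->
  (\esum_(z in setT) (b x z * w z)%:E = (W x * w x - laplacian b c w x)%:E)%E.
Proof.
move=> w0 sw; have bw0 z : 0 <= b x z * w z by rewrite mulr_ge0.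
have sw' : abs_summable (fun z => b x z * w z) by apply/abs_summable_ge0.
rewrite /laplacian (_ : (fun y => b x y * (w x - w y)) =
    fun y => w x * b x y + - (b x y * w y)); last by apply/funext => y; ring.
have sE := abs_summable_edge graph_bc x.
rewrite signed_sumD ?signed_sumN//; last 2 first.
- exact: abs_summableZ.
- by under eq_fun do rewrite -mulN1r; exact: abs_summableZ.
rewrite signed_sumZ// (edge_sumE graph_bc) [signed_sum (fun _ => _)]signed_sum_ge0//.
rewrite -[LHS]fineK ?abs_summable_fin//; congr EFin; ring.
Qed.

(** Lower semicontinuity of the energy under pointwise convergence: the bound passes to the limit
    for finite partial sums. *)
Lemma energy_lim_le (f_ : nat -> X -> R) f (M : R) :
  (forall x, f_ n x @[n --> \oo] --> f x) ->
  (forall n, (energy b c (f_ n) <= M%:E)%E) ->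
  (energy b c f <= M%:E)%E.
Proof.
move=> hf hM; have [h1 h2] := energy_terms_ge0 graph_bc f.
have fin (s : seq (X * X)) (t : seq X) : uniq s -> uniq t ->
    2^-1 * (\sum_(p <- s) b p.1 p.2 * (f p.1 - f p.2) ^+ 2) +
    \sum_(x <- t) c x * f x ^+ 2 <= M.
  move=> us ut.
  pose u n := 2^-1 * (\sum_(p <- s) b p.1 p.2 * (f_ n p.1 - f_ n p.2) ^+ 2) +
    \sum_(x <- t) c x * f_ n x ^+ 2.
  apply: (@cvgr_to_le _ \oo _ _ u).
    apply: cvgD; last first.
      apply: cvg_sum_seq => x; apply: cvgM; first exact: cvg_cst.
      by apply: cvgM; exact: hf.
    apply: cvgM; first exact: cvg_cst.
    apply: cvg_sum_seq => p; apply: cvgM; first exact: cvg_cst.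
    by apply: cvgM; apply: cvgB; exact: hf.
  apply: nearW => n; have [g1 g2] := energy_terms_ge0 graph_bc (f_ n).
  rewrite -lee_fin; apply: le_trans (hM n).
  rewrite /u EFinD EFinM -!sumEFin leeD ?lee_wpmul2l ?lee_fin ?invr_ge0//;
    by apply: sum_seq_le_esum => // ?; rewrite lee_fin.
(* The two infinite sums are bounded one after the other: first the one over pairs with [t] fixed,
   then the one over vertices, once the sum over pairs is known to be finite and can be moved to the
   other side. *)
have A (t : seq X) : uniq t ->
  (\esum_(p in [set: X * X]) (b p.1 p.2 * (f p.1 - f p.2) ^+ 2)%:E <=
   (2 * (M - \sum_(x <- t) c x * f x ^+ 2))%:E)%E.
  move=> ut; apply: esum_le_seq => s us; rewrite sumEFin lee_fin.
  have := fin s t us ut; set u := \sum_(p <- s) _; set v := \sum_(p <- t) _; lra.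
rewrite /energy; set E1 := (\esum_(p in [set: X * X]) _)%E in A *.
have E1_fin : E1 \is a fin_num.
  rewrite ge0_fin_numE; last by rewrite esum_ge0// => p _; rewrite lee_fin.
  exact: le_lt_trans (A [::] isT) (ltry _).
rewrite -(fineK E1_fin) in A *; rewrite -EFinM.
set e := fine E1 in A *.
have B : (\esum_(x in setT) (c x * f x ^+ 2)%:E <= (M - 2^-1 * e)%:E)%E.
  apply: esum_le_seq => t ut; rewrite sumEFin lee_fin.
  by have := A t ut; rewrite lee_fin; set v := \sum_(x <- t) _; lra.
apply: le_trans (leeD2l _ B) _.
by rewrite -EFinD addrC subrK.
Qed.

Section Bounded.
Variable y : X.
Hypothesis W0 : forall x, 0 < W x.
Hypothesis bounded : forall x, exists M, forall n, green_approx b c y n x <= M.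

Definition green_lim x := sup (range (fun n => green_approx b c y n x)).

Lemma green_lim_cvg x : green_approx b c y n x @[n --> \oo] --> green_lim x.
Proof.
apply: nondecreasing_cvgn; first exact: green_approx_homo.
by have [M hM] := bounded x; exists M => _ [n _ <-].
Qed.

Lemma green_lim_ge n x : green_approx b c y n x <= green_lim x.
Proof.
apply: sup_ubound; last by exists n.
by have [M hM] := bounded x; exists M => _ [m _ <-].
Qed.

Lemma green_lim_ge0 x : 0 <= green_lim x.
Proof. exact: le_trans (green_lim_ge 0 x). Qed.

(** Both inequalities are limits of the recursion: a finite part of the neighbour sum at stage n is
    bounded through stage n + 1, and each stage is bounded through the full neighbour sum of the
    limit. *)
Lemma green_lim_eq x :
  ((x == y)%:R%:E + \esum_(z in setT) (b x z * green_lim z)%:E =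
   (W x * green_lim x)%:E)%E.
Proof.
have bg0 z : 0 <= b x z * green_lim z by rewrite mulr_ge0// green_lim_ge0.
have le : (\esum_(z in setT) (b x z * green_lim z)%:E <=
    (W x * green_lim x - (x == y)%:R)%:E)%E.
  apply: (@esum_le_lim _ _ (fun n z => b x z * green_approx b c y n z)).
    by move=> z; apply: cvgM; [exact: cvg_cst|exact: green_lim_cvg].
  move=> s us; have sx := exhaust_near (x :: s).
  apply: filterS sx => n sn; rewrite lerBrDl.
  apply: (@le_trans _ _ (W x * green_approx b c y n.+1 x)); last first.
    by rewrite ler_pM2l// green_lim_ge.
  rewrite /= mem_exhaust ltnS ltnW; last by rewrite -mem_exhaust sn// mem_head.
  rewrite mulrC divfK ?gt_eqF// lerD2l ler_sum_subset ?exhaust_uniq// => z.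
    by move=> zs; rewrite sn// inE zs orbT.
  by rewrite mulr_ge0// green_approx_ge0.
apply/eqP; rewrite eq_le; apply/andP; split.
  apply: le_trans (leeD2l _ le) _; by rewrite -EFinD addrC subrK.
have S0 : (0 <= \esum_(z in setT) (b x z * green_lim z)%:E)%E.
  by rewrite esum_ge0// => z _; rewrite lee_fin.
have Sfin : (\esum_(z in setT) (b x z * green_lim z)%:E)%E \is a fin_num.
  by rewrite ge0_fin_numE// (le_lt_trans le) ?ltry.
rewrite -(fineK Sfin) -EFinD lee_fin.
apply: (@cvgr_to_le _ \oo _ _ (fun n => W x * green_approx b c y n x)).
  by apply: cvgM; [exact: cvg_cst|exact: green_lim_cvg].
apply: nearW => -[|n]; first by rewrite mulr0 addr_ge0// fine_ge0.
rewrite /=; case: ifP => _; last by rewrite mulr0 addr_ge0// fine_ge0.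
rewrite mulrC divfK ?gt_eqF// lerD2l -lee_fin fineK//.
rewrite -sumEFin; apply: le_trans (sum_seq_le_esum (exhaust_uniq n) _).
  by apply: lee_sum => z _; rewrite lee_fin ler_wpM2l// green_lim_ge.
by move=> z; rewrite lee_fin.
Qed.

Lemma green_lim_esum_lt x : (\esum_(z in setT) (b x z * green_lim z)%:E < +oo)%E.
Proof.
have := ltry (W x * green_lim x); rewrite -green_lim_eq.
by apply: le_lt_trans; rewrite leeDr// lee_fin.
Qed.

Lemma green_lim_laplacian x : laplacian b c green_lim x = (x == y)%:R.
Proof.
have := green_lim_eq x.
rewrite (esum_laplacian green_lim_ge0); last exact: green_lim_esum_lt.
by rewrite -EFinD => -[]; lra.
Qed.

Lemma green_lim_energy : (energy b c green_lim <= (green_lim y)%:E)%E.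
Proof.
apply: (@energy_lim_le (green_approx b c y)); first exact: green_lim_cvg.
move=> n; apply: le_trans (energy_green_approx_le _ _ _ _) _ => //.
by rewrite lee_fin green_lim_ge.
Qed.

Lemma green_lim_finite_energy : finite_energy b c green_lim.
Proof. exact: le_lt_trans green_lim_energy (ltry _). Qed.

Lemma green_lim_bounded_at : bounded_at b c y.
Proof.
exact: (bounded_at_pole graph_bc green_lim_finite_energy green_lim_laplacian).
Qed.

(** With u the approximation and g its limit, Green's formula gives Q(g - u) = Q(g) - sum u (2 L g -
    L u). On [exhaust n] one has L g = 1_y >= L u, so the sum is at least u(y), while Q(g) <=
    g(y). *)
Lemma energy_green_lim_sub n :
  (energy b c (fun x => (green_lim x - green_approx b c y n x)%R) <=
   (green_lim y - green_approx b c y n y)%:E)%E.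
Proof.
have supp x : x \notin exhaust n -> - green_approx b c y n x = 0.
  by move=> xn; rewrite green_approx_supp// oppr0.
rewrite (energy_add_seq graph_bc (exhaust_uniq n) supp green_lim_finite_energy).
apply: le_trans (leeD2r _ green_lim_energy) _.
rewrite -EFinD lee_fin lerD2l.
have apx_supp := @green_approx_supp _ _ b c y n.
rewrite -(sum_pole y (exhaust_uniq n) apx_supp) -sumrN big_seq [leRHS]big_seq.
apply: ler_sum => x xn; rewrite mulNr lerN2.
have sapx := abs_summable_diff_seq graph_bc x apx_supp.
rewrite laplacianN// green_lim_laplacian ler_wpM2l ?green_approx_ge0//.
by have := laplacian_green_approx_le graph_bc y W0 xn; lra.
Qed.

End Bounded.
End Limit.

(** * Transience *)

Lemma indic_set1 (R : pzRingType) (T : eqType) (x y : T) :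
  \1_[set y] x = (x == y)%:R :> R.
Proof.
by rewrite indicE; have [->|/eqP xy] := eqVneq x y; [rewrite mem_set|rewrite memNset].
Qed.

Section Transience.
Context {R : realType} {X : countType} (b : X -> X -> R) (c : X -> R) (o : X).
Hypothesis graph_bc : is_graph b c.
Implicit Types (f g w phi : X -> R) (s : seq X) (x y z : X).

Local Notation W := (weight b c).
Let b0 x y : 0 <= b x y := graph_edge_ge0 graph_bc x y.
Let c0 x : 0 <= c x := graph_kill_ge0 graph_bc x.

Lemma energy_norm_lt f (e : R) : 0 < e ->
  (energy_norm o b c f < e%:E)%E = (energy b c f + (f o ^+ 2)%:E < (e ^+ 2)%:E)%E.
Proof.
move=> e0; rewrite /energy_norm real_normK ?num_real//.
have h : (0 <= energy b c f + (f o ^+ 2)%:E)%E.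
  by rewrite adde_ge0 ?lee_fin ?sqr_ge0// energy_ge0.
have -> : e%:E = sqrte (e ^+ 2)%:E by rewrite /sqrte sqrtr_sqr gtr0_norm.
by rewrite !ltNge lee_sqrt.
Qed.

Lemma finitely_supported_seq phi : finitely_supported phi ->
  exists2 s, uniq s & forall x, x \notin s -> phi x = 0.
Proof.
move=> fphi; exists (finmap.enum_fset (fset_set [set x | phi x != 0])); first exact: finmap.fset_uniq.
move=> x; rewrite in_fset_set// => /negP xs; apply/eqP; rewrite -[_ == _]negbK.
by apply/negP => px; apply: xs; rewrite mem_set.
Qed.

Lemma seq_finitely_supported s phi : (forall x, x \notin s -> phi x = 0) ->
  finitely_supported phi.
Proof.
move=> p0; apply: (@sub_finite_set _ _ [set` s]); last exact: finite_seq.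
move=> x /= px; apply: contraNT px => xs; exact/eqP/p0.
Qed.

Lemma energyB_le f g :
  (energy b c (fun x => f x - g x)%R <= 2%:E * energy b c f + 2%:E * energy b c g)%E.
Proof.
have [f1 f2] := energy_terms_ge0 graph_bc f.
have [g1 g2] := energy_terms_ge0 graph_bc g.
have sqrB_le (u v : R) : (u - v) ^+ 2 <= 2 * u ^+ 2 + 2 * v ^+ 2.
  by have := sqr_ge0 (u + v); nra.
have E1 : (\esum_(p in [set: X * X])
      (b p.1 p.2 * ((f p.1 - g p.1) - (f p.2 - g p.2)) ^+ 2)%:E <=
    2%:E * (\esum_(p in [set: X * X]) (b p.1 p.2 * (f p.1 - f p.2) ^+ 2)%:E) +
    2%:E * (\esum_(p in [set: X * X]) (b p.1 p.2 * (g p.1 - g p.2) ^+ 2)%:E))%E.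
  rewrite -!esumZ// -esumD//; last 2 first.
  - by move=> p _; rewrite mule_ge0 ?lee_fin.
  - by move=> p _; rewrite mule_ge0 ?lee_fin.
  apply: le_esum => p _; rewrite -!EFinM -EFinD lee_fin.
  rewrite !(mulrCA 2 (b _ _)) -mulrDr ler_wpM2l//.
  have -> : f p.1 - g p.1 - (f p.2 - g p.2) = (f p.1 - f p.2) - (g p.1 - g p.2) by ring.
  exact: sqrB_le.
have E2 : (\esum_(x in setT) (c x * (f x - g x) ^+ 2)%:E <=
    2%:E * (\esum_(x in setT) (c x * f x ^+ 2)%:E) +
    2%:E * (\esum_(x in setT) (c x * g x ^+ 2)%:E))%E.
  rewrite -!esumZ// -esumD//; last 2 first.
  - by move=> p _; rewrite mule_ge0 ?lee_fin.
  - by move=> p _; rewrite mule_ge0 ?lee_fin.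
  apply: le_esum => p _; rewrite -!EFinM -EFinD lee_fin.
  by rewrite !(mulrCA 2 (c _)) -mulrDr ler_wpM2l.
rewrite /energy; apply: le_trans (leeD (lee_wpmul2l _ E1) E2) _.
  by rewrite lee_fin invr_ge0.
have esum0 (T : choiceType) (a : T -> R) : (forall t : T, 0 <= a t) ->
    (0 <= \esum_(t in [set: T]) (a t)%:E)%E.
  by move=> a0; rewrite esum_ge0// => x _; rewrite lee_fin.
have := esum0 _ _ f1; set F1 := (\esum_(p in _) _)%E => F10.
have := esum0 _ _ f2; set F2 := (\esum_(p in _) _)%E => F20.
have := esum0 _ _ g1; set G1 := (\esum_(p in _) _)%E => G10.
have := esum0 _ _ g2; set G2 := (\esum_(p in _) _)%E => G20.
have h2 : (0 <= (2^-1 : R)%:E)%E by rewrite lee_fin invr_ge0.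
have t2 : (0 <= (2 : R)%:E)%E by rewrite lee_fin.
rewrite !muleDr ?ge0_adde_def ?inE ?mule_ge0//.
by rewrite !(muleCA (2^-1)%:E) addeACA.
Qed.

(** The difference [d] satisfies L d = 0, so it is orthogonal in energy to the finitely supported
    functions, which also approximate it; hence its energy vanishes. Then [d] is constant along
    edges, and the same approximation gives the value 0 at [o]. *)
Lemma green_unique y g g' : graph_connected b -> bounded_at b c o ->
  is_green o b c y g -> is_green o b c y g' -> g = g'.
Proof.
move=> conn [C C0 hC] [[Eg ag] _ Lg] [[Eg' ag'] _ Lg'].
pose d x := g x - g' x.
have Ed : finite_energy b c d.
  apply: le_lt_trans (energyB_le g g') _.
  by rewrite lte_add_pinfty// lte_mul_pinfty//.
have sg' x : abs_summable (fun z => b x z * (- g' x - - g' z)).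
  under eq_fun do rewrite -opprD mulrN -mulN1r.
  by apply: abs_summableZ; exact: (finite_energy_diff graph_bc).
have Ld x : laplacian b c d x = 0.
  rewrite /d laplacianD//; last exact: (finite_energy_diff graph_bc).
  by rewrite laplacianN ?Lg ?Lg' ?subrr//; exact: (finite_energy_diff graph_bc).
have Ed_fin : energy b c d = (fine (energy b c d))%:E.
  by rewrite fineK// ge0_fin_numE// energy_ge0.
set q := fine (energy b c d) in Ed_fin.
have q0 : 0 <= q by rewrite fine_ge0// energy_ge0.
(* The constant collects 4 for [q], 8 for the two approximation errors at [o], and 8 C for [psi o],
   which [hC] controls. *)
have small (e : R) : 0 < e -> d o ^+ 2 + q <= (12 + 8 * C) * e ^+ 2.
  move=> e0.
  have [phi fphi] := ag e e0; rewrite energy_norm_lt// => Ephi.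
  have [phi' fphi'] := ag' e e0; rewrite energy_norm_lt// => Ephi'.
  have [s us sphi] := finitely_supported_seq fphi.
  have [s' us' sphi'] := finitely_supported_seq fphi'.
  (* Then [d + psi] is the difference of the two approximation errors, and L d = 0 removes the mixed
     term, so that its energy is the sum of those of [d] and [psi]. *)
  pose psi x := phi' x - phi x.
  have spsi x : x \notin undup (s ++ s') -> psi x = 0.
    rewrite mem_undup mem_cat negb_or => /andP[xs xs'].
    by rewrite /psi sphi// sphi'// subrr.
  have ut := undup_uniq (s ++ s').
  have [E EE E0] := energy_seq_fin graph_bc ut spsi.
  have sumE : energy b c (fun x => d x + psi x) = (q + E)%:E.
    rewrite (energy_add_seq graph_bc ut spsi Ed) Ed_fin -EFinD.
    move: EE; rewrite (energy_seq graph_bc ut spsi) => -[<-]; congr (_ + _)%:E.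
    by apply: eq_bigr => x _; rewrite Ld mulr0 add0r.
  have := energyB_le (fun x => g x - phi x) (fun x => g' x - phi' x).
  rewrite (_ : (fun x => _ - _ - _) = fun x => d x + psi x); last first.
    by apply/funext => x; rewrite /d /psi; ring.
  rewrite sumE.
  have fin_of f (r : R) : (energy b c f + (f o ^+ 2)%:E < r%:E)%E ->
      exists u : R, [/\ energy b c f = u%:E, 0 <= u & u + f o ^+ 2 < r].
    move=> h; have : energy b c f \is a fin_num.
      rewrite ge0_fin_numE ?energy_ge0//; apply: le_lt_trans (ltry r).
      by apply: le_trans (ltW h); rewrite leeDl// lee_fin sqr_ge0.
    move=> /fineK hf; exists (fine (energy b c f)); split => //.
      by rewrite fine_ge0// energy_ge0.
    by rewrite -lte_fin EFinD hf.
  have [u [-> u0 hu]] := fin_of _ _ Ephi; have [u' [-> u0' hu']] := fin_of _ _ Ephi'.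
  rewrite -!EFinM -EFinD lee_fin => hqE.
  have := hC _ _ ut spsi; rewrite EE -EFinM lee_fin => hpsi.
  have p1 := sqr_ge0 (g o - phi o); have p2 := sqr_ge0 (g' o - phi' o).
  have hE : E <= 4 * e ^+ 2 by lra.
  have hCE : C * E <= C * (4 * e ^+ 2) by rewrite ler_pM2l.
  have hd : d o ^+ 2 <= 2 * (2 * (g o - phi o) ^+ 2 + 2 * (g' o - phi' o) ^+ 2) +
     2 * psi o ^+ 2.
    have -> : d o = (g o - phi o) - (g' o - phi' o) - psi o by rewrite /d /psi; ring.
    move: (g o - phi o) (g' o - phi' o) (psi o) => v v' p.
    by have := sqr_ge0 (v + v'); have := sqr_ge0 (v - v' + p); nra.
  have -> : (12 + 8 * C) * e ^+ 2 = 12 * e ^+ 2 + 2 * (C * (4 * e ^+ 2)) by ring.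
  lra.
(* A positive value t is refuted by e^2 = t / (2 (12 + 8 C)), which gives t <= t / 2. *)
have dq0 : d o ^+ 2 + q = 0.
  apply/eqP; rewrite eq_le addr_ge0 ?sqr_ge0// andbT leNgt; apply/negP => pos.
  have K0 : 0 < 2 * (12 + 8 * C) by lra.
  have t0 : 0 < (d o ^+ 2 + q) / (2 * (12 + 8 * C)) by rewrite divr_gt0.
  have := small (Num.sqrt ((d o ^+ 2 + q) / (2 * (12 + 8 * C)))).
  rewrite sqrtr_gt0 t0 sqr_sqrtr ?(ltW t0)// => /(_ isT).
  set t := d o ^+ 2 + q in pos *.
  rewrite (_ : (12 + 8 * C) * _ = t / 2); first by lra.
  by field; apply: lt0r_neq0; lra.
have qz : q = 0 by have := sqr_ge0 (d o); lra.
have doz : d o = 0 by apply/eqP; rewrite -sqrf_eq0; apply/eqP; lra.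
have edge x z : 0 < b x z -> d x = 0 -> d z = 0.
  move=> bxz dx; have := edge_energy_le graph_bc d x z.
  rewrite Ed_fin qz lee_fin dx sub0r sqrrN pmulr_rle0// => dz.
  by apply/eqP; rewrite -sqrf_eq0 eq_le dz sqr_ge0.
apply/funext => x; apply/eqP; rewrite -subr_eq0; apply/eqP; rewrite -/(d x).
have [p [op <-]] := conn o x.
suff walk z : d z = 0 -> path (fun u v => 0 < b u v) z p -> d (last z p) = 0 by exact: walk op.
elim: p {op} z => //= z' p IH z dz /andP[bz zp].
exact: IH (edge _ _ bz dz) zp.
Qed.

Section Bounded.
Hypothesis bounded : forall z, bounded_at b c z.

Let W0 x : 0 < W x. Proof. exact: bounded_at_weight. Qed.
Let apx_bounded y x : exists M, forall n, green_approx b c y n x <= M.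
Proof. exact: green_approx_bounded. Qed.

Lemma green_lim_is_green y : is_green o b c y (green_lim b c y).
Proof.
split.
- split; first exact: green_lim_finite_energy.
  move=> e e0.
  (* By [energy_green_lim_sub], [r n] bounds the square of the energy norm of the limit minus its
     approximation at stage n; the approximations themselves thus show membership in D_0. *)
  pose r n := (green_lim b c y y - green_approx b c y n y) +
    (green_lim b c y o - green_approx b c y n o) * (green_lim b c y o - green_approx b c y n o).
  have cr x : (green_lim b c y x - green_approx b c y n x) @[n --> \oo] --> (0 : R).
    rewrite -(subrr (green_lim b c y x)).
    by apply: cvgB; [exact: cvg_cst|exact: green_lim_cvg].
  have : r n @[n --> \oo] --> (0 + 0 * 0 : R) by apply: cvgD => //; exact: cvgM.
  rewrite mulr0 addr0 => /cvgr_lt /(_ (e ^+ 2)) []; first by rewrite exprn_gt0.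
  move=> n _ /(_ n (leqnn n)) rn.
  exists (green_approx b c y n).
    by apply: (@seq_finitely_supported (exhaust n)) => x; exact: green_approx_supp.
  have Esub := energy_green_lim_sub graph_bc W0 (apx_bounded y) n.
  rewrite energy_norm_lt//; apply: le_lt_trans (leeD2r _ Esub) _.
  by rewrite -EFinD lte_fin [X in _ + X]expr2.
- move=> x; under eq_esum do rewrite ger0_norm ?green_lim_ge0//.
  exact: green_lim_esum_lt.
- by move=> x; rewrite green_lim_laplacian// indic_set1.
Qed.

Lemma bounded_at_transient : graph_connected b -> transient o b c.
Proof.
move=> conn y; exists (green_lim b c y); split; first exact: green_lim_is_green.
by move=> g; apply: green_unique => //; exact: green_lim_is_green.
Qed.

Lemma greenE x y : graph_connected b -> green o b c x y = (green_lim b c y x)%:E.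
Proof.
move=> conn; rewrite /green; case: asboolP => [_|]; last first.
  by move=> h; have := bounded_at_transient conn.
congr (_%:E); suff -> : xget (cst 0) (is_green o b c y) = green_lim b c y by [].
apply: (green_unique conn (bounded o)); last exact: green_lim_is_green.
by apply: xgetPex; exists (green_lim b c y); exact: green_lim_is_green.
Qed.

End Bounded.

(** Together with [bounded_at_transient], this identifies transience of a connected graph with
    bounded point evaluations, a property that can be carried from vertex to vertex. *)
Lemma transient_bounded_at y : transient o b c -> bounded_at b c y.
Proof.
move=> /(_ y)[g [[[Eg _] _ Lg] _]].
by apply: (bounded_at_pole graph_bc Eg) => x; rewrite Lg indic_set1.
Qed.

(** The function w / a bounds all approximations with pole [y], so their limit exists and has finite
    energy. This detects transience from a single function that is strictly superharmonic at [y]. *)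
Lemma superharmonic_bounded_at (a : R) y w : 0 < a -> (forall x, 0 < W x) ->
  supersolution b c (fun x => a * (x == y)%:R) w -> bounded_at b c y.
Proof.
move=> a0 W0 sw; apply: green_lim_bounded_at => // x.
by exists (w x / a) => n; exact: green_approx_pole_le.
Qed.

End Transience.

(** * Green operators *)

Section GreenOperator.
Context {R : realType} {X : countType} (b : X -> X -> R) (c : X -> R) (o : X).
Hypothesis graph_bc : is_graph b c.
Hypothesis connected_b : graph_connected b.
Implicit Types (f w v : X -> R) (s : seq X) (x y z : X).

Local Notation W := (weight b c).
Let b0 x y : 0 <= b x y := graph_edge_ge0 graph_bc x y.

(** The off-diagonal part of the operator as a real number, which turns supersolution conditions
    into linear inequalities over the reals. *)
Definition neighbor_sum w x := signed_sum (fun z => b x z * w z).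

Lemma supersolutionP f w : (forall x, 0 <= f x) -> supersolution b c f w <->
  (forall x, 0 <= w x) /\ forall x, abs_summable (fun z => b x z * w z) /\
     f x + neighbor_sum w x <= W x * w x.
Proof.
move=> f0; have bw0 x : (forall z, 0 <= w z) -> forall z, 0 <= b x z * w z.
  by move=> w0 z; rewrite mulr_ge0.
split=> -[w0 fw]; split=> // x.
  have sw : abs_summable (fun z => b x z * w z).
    apply/abs_summable_ge0; first exact: bw0.
    apply: le_lt_trans (ltry (W x * w x)); apply: le_trans (fw x).
    by rewrite leeDr// lee_fin.
  split=> //; rewrite /neighbor_sum signed_sum_ge0; last exact: bw0.
  by rewrite -lee_fin EFinD fineK ?fw// abs_summable_fin//; exact: bw0.
have [sw] := fw x; rewrite /neighbor_sum signed_sum_ge0; last exact: bw0.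
by rewrite -lee_fin EFinD fineK// abs_summable_fin//; exact: bw0.
Qed.

Lemma neighbor_sum_cst k x : neighbor_sum (fun=> k) x = (W x - c x) * k.
Proof.
rewrite /neighbor_sum; under eq_fun do rewrite mulrC.
rewrite signed_sumZ; last exact: (abs_summable_edge graph_bc).
by rewrite (edge_sumE graph_bc) mulrC.
Qed.

Lemma abs_summable_cst k x : abs_summable (fun z => b x z * k).
Proof.
under eq_fun do rewrite mulrC.
by apply: abs_summableZ; exact: (abs_summable_edge graph_bc).
Qed.

Lemma neighbor_sumD v w x :
  abs_summable (fun z => b x z * v z) -> abs_summable (fun z => b x z * w z) ->
  abs_summable (fun z => b x z * (v z + w z)) /\
  neighbor_sum (fun z => v z + w z) x = neighbor_sum v x + neighbor_sum w x.
Proof.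
move=> sv sw; rewrite /neighbor_sum; under eq_fun do rewrite mulrDr.
by rewrite signed_sumD//; split => //; exact: abs_summableD.
Qed.

Lemma neighbor_sumZ k w x : abs_summable (fun z => b x z * w z) ->
  abs_summable (fun z => b x z * (k * w z)) /\
  neighbor_sum (fun z => k * w z) x = k * neighbor_sum w x.
Proof.
move=> sw; rewrite /neighbor_sum; under eq_fun do rewrite mulrCA.
by rewrite signed_sumZ//; split => //; exact: abs_summableZ.
Qed.

Lemma neighbor_sum_le v w x : (forall z, 0 <= v z <= w z) ->
  abs_summable (fun z => b x z * w z) ->
  abs_summable (fun z => b x z * v z) /\ neighbor_sum v x <= neighbor_sum w x.
Proof.
move=> vw sw.
have v0 z : 0 <= b x z * v z by have /andP[? _] := vw z; rewrite mulr_ge0.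
have le z : b x z * v z <= b x z * w z by have /andP[_ ?] := vw z; rewrite ler_wpM2l.
have w0 z : 0 <= b x z * w z by exact: le_trans (le z).
have sv : abs_summable (fun z => b x z * v z).
  by apply: abs_summable_le sw => z; rewrite !ger0_norm.
split=> //; rewrite /neighbor_sum !signed_sum_ge0// fine_le ?abs_summable_fin//.
by apply: le_esum => z _; rewrite lee_fin.
Qed.

Section Bounded.
Hypothesis bounded : forall z, bounded_at b c z.

Let W0 x : 0 < W x. Proof. exact: bounded_at_weight. Qed.
Let W_ge0 x : 0 <= W x. Proof. exact: weight_ge0. Qed.
Let apx_bounded y x : exists M, forall n, green_approx b c y n x <= M.
Proof. exact: green_approx_bounded. Qed.

Lemma green_opE f x : green_op o b c f x =
  (\esum_(y in setT) (green_lim b c y x * f y)%:E)%E.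
Proof. by apply: eq_esum => y _; rewrite greenE. Qed.

(** Finite combinations of approximations lie below [w], and the bound survives the limit in n and
    the supremum over finite sets of poles. *)
Lemma green_op_le f w x : (forall y, 0 <= f y) -> supersolution b c f w ->
  (green_op o b c f x <= (w x)%:E)%E.
Proof.
move=> f0 sw; rewrite green_opE; apply: esum_le_seq => s us.
rewrite sumEFin lee_fin; under eq_bigr do rewrite mulrC.
apply: (@sum_seq_lim_le _ _ _ (fun n y => f y * green_approx b c y n x)).
  by move=> y; apply: cvgM; [exact: cvg_cst|exact: green_lim_cvg].
by apply: nearW => n; exact: green_approx_le.
Qed.

(** Equality holds here: the equation [green_lim_eq] of each pole is multiplied by [f y] and summed
    over the poles, and the two nonnegative sums are exchanged. *)
Lemma green_op_supersolution f v : (forall y, 0 <= f y) ->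
  (forall x, green_op o b c f x = (v x)%:E) -> supersolution b c f v.
Proof.
move=> f0 fv; have g0 x y : 0 <= green_lim b c y x by exact: green_lim_ge0.
split=> x; first by rewrite -lee_fin -fv green_opE esum_ge0// => y _; rewrite lee_fin mulr_ge0.
rewrite EFinM -fv green_opE -esumZ//; last by move=> y; rewrite lee_fin mulr_ge0.
rewrite le_eqVlt; apply/orP; left; apply/eqP.
transitivity (\esum_(y in setT) (((x == y)%:R * f y)%:E +
    \esum_(z in setT) (b x z * (green_lim b c y z * f y))%:E))%E; last first.
  apply: eq_esum => y _; rewrite -[RHS]EFinM [in RHS]mulrA [RHS]EFinM -green_lim_eq//.
  rewrite ge0_muleDl ?lee_fin//; last first.
    by rewrite esum_ge0// => z _; rewrite lee_fin mulr_ge0.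
  congr (_ + _)%E; rewrite muleC -esumZ//; last by move=> z; rewrite lee_fin mulr_ge0.
  by apply: eq_esum => z _; rewrite -EFinM mulrA mulrC.
rewrite esumD//; last 2 first.
- by move=> y _; rewrite lee_fin mulr_ge0.
- by move=> y _; rewrite esum_ge0// => z _; rewrite lee_fin !mulr_ge0.
congr (_ + _)%E.
  transitivity (\esum_(y in [set x]) (f y)%:E)%E; first by rewrite esum_set1// lee_fin.
  rewrite esum_mkcond; apply: eq_esum => y _.
  have [->|/eqP yx] := eqVneq x y; first by rewrite mem_set// mul1r.
  by rewrite memNset ?mul0r// => /= /esym.
rewrite esum_exchange; last by move=> y z; rewrite lee_fin !mulr_ge0.
apply: eq_esum => z _; rewrite EFinM -fv green_opE -esumZ//.
by move=> y; rewrite lee_fin mulr_ge0.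
Qed.

(** A Harnack inequality: keeping one term of [green_lim_eq] gives b(x,z) G(z,y) <= W(x) G(x,y) for
    every pole y. *)
Lemma green_op_fin_edge f x z : (forall y, 0 <= f y) -> 0 < b x z ->
  (green_op o b c f x < +oo)%E -> (green_op o b c f z < +oo)%E.
Proof.
move=> f0 bxz; rewrite !green_opE => fx.
have g0 u y : 0 <= green_lim b c y u by exact: green_lim_ge0.
have g0' u y : (0 <= (green_lim b c y u * f y)%:E)%E by rewrite lee_fin mulr_ge0.
have : ((b x z)%:E * (\esum_(y in setT) (green_lim b c y z * f y)%:E) <=
    (W x)%:E * (\esum_(y in setT) (green_lim b c y x * f y)%:E))%E.
  rewrite -!esumZ//; apply: le_esum => y _.
  rewrite -!EFinM lee_fin !mulrA ler_wpM2r// -lee_fin -green_lim_eq//.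
  apply: (@le_trans _ _ (\esum_(z in setT) (b x z * green_lim b c y z)%:E)%E).
    apply: (@term_le_esum _ _ (fun z => (b x z * green_lim b c y z)%:E)) => u.
    by rewrite lee_fin mulr_ge0.
  by rewrite leeDr// lee_fin.
have Wfx : ((W x)%:E * (\esum_(y in setT) (green_lim b c y x * f y)%:E) < +oo)%E.
  by apply: lte_mul_pinfty => //; rewrite lee_fin.
move=> /le_lt_trans /(_ Wfx).
by case: (esum _ _) => // [r _|]; rewrite ?ltry// gt0_muley.
Qed.

Lemma green_op_fin f x z : (forall y, 0 <= f y) ->
  (green_op o b c f x < +oo)%E -> (green_op o b c f z < +oo)%E.
Proof.
move=> f0; have [p [+ <-]] := connected_b x z.
elim: p x => //= u p IH x /andP[bxu up] fx.
by apply: IH up _; exact: green_op_fin_edge bxu fx.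
Qed.

Lemma green_op_real f x : (forall y, 0 <= f y) -> (green_op o b c f x < +oo)%E ->
  exists v, forall z, green_op o b c f z = (v z)%:E.
Proof.
move=> f0 fx; exists (fun z => fine (green_op o b c f z)) => z; rewrite fineK// ge0_fin_numE ?(green_op_fin z f0 fx)//.
by rewrite green_opE esum_ge0// => y _; rewrite lee_fin mulr_ge0// green_lim_ge0.
Qed.

End Bounded.
End GreenOperator.

(** * Thick sets and the killing term *)

Section Killing.
Context {R : realType} {X : countType} (b : X -> X -> R) (c : X -> R) (o : X).
Hypothesis graph_bc : is_graph b c.
Hypothesis connected_b : graph_connected b.
Implicit Types (f s v w : X -> R) (A : set X) (x y z : X).

Local Notation superharmonic := (supersolution b no_killing (fun=> 0)).
Let b0 x y : 0 <= b x y := graph_edge_ge0 graph_bc x y.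
Let c0 x : 0 <= c x := graph_kill_ge0 graph_bc x.

Lemma no_killing_graph : is_graph b no_killing.
Proof.
split=> [x y|x y|x|x|x].
- exact: b0.
- exact: graph_edge_sym graph_bc x y.
- exact: graph_edge_diag graph_bc x.
- exact: graph_edge_sum graph_bc x.
- exact: lexx.
Qed.

Lemma neighbor_sum_cst_no_killing (k : R) x :
  neighbor_sum b (fun=> k) x = weight b no_killing x * k.
Proof.
rewrite (neighbor_sum_cst no_killing_graph).
by have -> : no_killing x = 0 :> R by []; rewrite subr0.
Qed.

Lemma weight_killing x : weight b c x = weight b no_killing x + c x.
Proof. by rewrite /weight addr0. Qed.

Lemma superharmonicP s : superharmonic s <->
  [/\ forall x, 0 <= s x, formal_domain b s &
     forall x, 0 <= laplacian b no_killing s x].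
Proof.
have fdE : (forall x, 0 <= s x) -> formal_domain b s <->
    forall x, (\esum_(z in setT) (b x z * s z)%:E < +oo)%E.
  move=> s0; rewrite /formal_domain/=; split=> h x.
    by have := h x; under eq_esum do rewrite ger0_norm//.
  by under eq_esum do rewrite ger0_norm//.
split=> [[s0 ss]|[s0 Fs Ls]].
  have sF x : (\esum_(z in setT) (b x z * s z)%:E < +oo)%E.
    by apply: le_lt_trans (ltry (weight b no_killing x * s x)); rewrite -[leLHS]add0e.
  split=> // [|x]; first exact/fdE.
  have := ss x; rewrite (esum_laplacian no_killing_graph)// add0e lee_fin; lra.
split=> // x; rewrite (esum_laplacian no_killing_graph)//; last exact: (proj1 (fdE s0)).
by rewrite -EFinD lee_fin; have := Ls x; lra.
Qed.

(** A path from [x] to [u] either starts with an edge at [x] or is empty, in which case the edge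
    from [u] to [v] serves. *)
Lemma weight_edge_gt0 x (u v : X) : 0 < b u v -> 0 < weight b no_killing x.
Proof.
move=> buv; have edge y z : 0 < b y z -> 0 < weight b no_killing y.
  move=> byz; rewrite /weight addr0; apply: lt_le_trans byz _.
  rewrite -lee_fin fineK; last first.
    by apply: abs_summable_fin => //; exact: (abs_summable_edge graph_bc).
  by apply: (@term_le_esum _ _ (fun z => (b y z)%:E)) => t; rewrite lee_fin.
have [[|z p] [/= xp pu]] := connected_b x u; first by rewrite pu; exact: edge buv.
by case/andP: xp => xz _; exact: edge xz.
Qed.

(** The second part is quantitative: where [s v] reaches [k], the truncation equals [k], and each
    neighbour at which it is below [k] contributes to its Laplacian at [v]. *)
Lemma superharmonic_min s (k : R) : 0 <= k -> superharmonic s ->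
  superharmonic (fun x => Num.min (s x) k) /\
  forall v : X, k <= s v -> forall u,
    b v u * (k - Num.min (s u) k) + neighbor_sum b (fun x => Num.min (s x) k) v <=
    weight b no_killing v * k.
Proof.
move=> k0 ss.
have [s0 sP] := (supersolutionP no_killing_graph _ (fun=> lexx 0)).1 ss.
have m0 x : 0 <= Num.min (s x) k by rewrite le_min s0.
have ms x : 0 <= Num.min (s x) k <= s x by rewrite m0 ge_min lexx.
have mk x : 0 <= Num.min (s x) k <= k by rewrite m0 ge_min lexx orbT.
have sk x := abs_summable_cst no_killing_graph k x.
split.
  apply/(supersolutionP no_killing_graph) => //; split=> // x.
  have [sx hx] := sP x.
  have [sm h1] := neighbor_sum_le no_killing_graph ms sx; split=> //.
  have [_] := neighbor_sum_le no_killing_graph mk (sk x).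
  rewrite neighbor_sum_cst_no_killing => h2.
  by case: (leP (s x) k) => _; lra.
move=> v kv u.
have [sm _] := neighbor_sum_le no_killing_graph mk (sk v).
(* The neighbour sum of this gap at [v] is the whole Laplacian of the truncation there; only the
   term at [u] is kept. *)
pose r z := k - Num.min (s z) k.
have r0 z : 0 <= r z by rewrite subr_ge0 ge_min lexx orbT.
have rk z : 0 <= r z <= k by rewrite r0 gerBl m0.
have [sr _] := neighbor_sum_le no_killing_graph rk (sk v).
have [_ rmE] := neighbor_sumD sr sm.
have : neighbor_sum b (fun=> k) v = neighbor_sum b r v +
    neighbor_sum b (fun z => Num.min (s z) k) v.
  rewrite -rmE (_ : (fun=> k) = fun z => r z + Num.min (s z) k)//.
  by apply/funext => z; rewrite /r subrK.
rewrite neighbor_sum_cst_no_killing => ->.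
rewrite lerD2r /neighbor_sum signed_sum_ge0; last by move=> z; rewrite mulr_ge0.
rewrite -lee_fin fineK; last by rewrite abs_summable_fin// => z; rewrite mulr_ge0.
by apply: (@term_le_esum _ _ (fun z => (b v z * r z)%:E)) => z; rewrite lee_fin mulr_ge0.
Qed.

(** If [s] drops along an edge from v' to u', truncating at s(v') gives a supersolution with a
    positive source at v'. This forces positive capacity there, hence transience. *)
Lemma superharmonic_const s : ~ transient o b no_killing -> superharmonic s ->
  forall x y, s x = s y.
Proof.
move=> ntr ss.
have edge (u v : X) : 0 < b u v -> s u = s v.
  have key (u' v' : X) : 0 < b v' u' -> s v' <= s u'.
    move=> bvu; rewrite leNgt; apply/negP => suv; apply: ntr.
    have s0 := ss.1.
    have [ms strict] := superharmonic_min (s0 v') ss.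
    have := strict v' (lexx _) u'; rewrite (min_l (ltW suv)).
    set a := b v' u' * _ => ha.
    have a0 : 0 < a by rewrite mulr_gt0// subr_gt0.
    have W0 x : 0 < weight b no_killing x by exact: weight_edge_gt0 bvu.
    have f0 x : 0 <= a * (x == v')%:R by rewrite mulr_ge0// ltW.
    apply: (bounded_at_transient o no_killing_graph _ connected_b) => z.
    apply: (bounded_at_connected no_killing_graph z connected_b).
    apply: (superharmonic_bounded_at no_killing_graph a0 W0).
    apply/(supersolutionP no_killing_graph _ f0); split; first exact: ms.1.
    move=> x; have [_ /(_ x)[sm hm]] :=
      (supersolutionP no_killing_graph _ (fun=> lexx 0)).1 ms.
    split; first exact: sm.
    have [->|xv] := eqVneq x v'; last by rewrite mulr0.
    by rewrite mulr1 minxx.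
  move=> buv; apply/eqP; rewrite eq_le !key//.
  by rewrite (graph_edge_sym graph_bc).
move=> x y; have [p [+ <-]] := connected_b x y.
by elim: p x => //= z p IH x /andP[xz zp]; rewrite (edge _ _ xz); exact: IH.
Qed.

Lemma restrict_ge0 A y : 0 <= \1_A y * c y :> R.
Proof. by rewrite indicE mulr_ge0. Qed.

(** * The function Gc, and the case where the graph without killing is not transient *)

Section Transient.
Hypothesis transient_bc : transient o b c.
Let bounded_bc z : bounded_at b c z := transient_bounded_at graph_bc z transient_bc.

(** The constant 1 has Laplacian exactly [c], so minimality yields Gc <= 1. *)
Lemma supersolution_one : supersolution b c c (fun=> 1).
Proof.
apply/(supersolutionP graph_bc) => //; split=> // x.
split; first exact: abs_summable_cst graph_bc 1 x.
by rewrite (neighbor_sum_cst graph_bc); lra.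
Qed.

Lemma green_op_kill_supersolution : exists v,
  [/\ forall x, green_op o b c c x = (v x)%:E, supersolution b c c v &
      forall x, v x <= 1].
Proof.
have le1 x : (green_op o b c c x <= 1%:E)%E.
  exact: green_op_le supersolution_one.
have [v vE] := green_op_real graph_bc connected_b bounded_bc c0
  (le_lt_trans (le1 o) (ltry 1)).
exists v; split=> // [|x]; first exact: green_op_supersolution vE.
by rewrite -lee_fin -vE.
Qed.

Lemma killing_neq0 : ~ transient o b no_killing -> exists x, c x != 0.
Proof.
move=> ntr; apply: contrapT => /forallNP c00; apply: ntr.
rewrite (_ : no_killing = c)//; apply/funext => x; apply/eqP.
by have /negP := c00 x; rewrite negbK eq_sym.
Qed.

(** As v = Gc is at most 1, it is superharmonic without killing, hence constant. Where c(z) > 0, a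
    constant v with L v >= c satisfies v >= 1. *)
Lemma recurrent_green_op_kill : ~ transient o b no_killing ->
  forall x, green_op o b c c x = 1%E.
Proof.
move=> ntr x; have [v [vE sv v1]] := green_op_kill_supersolution.
have [v0 vP] := (supersolutionP graph_bc _ c0).1 sv.
have v_sh : superharmonic v.
  apply/(supersolutionP no_killing_graph) => //; split=> // z; have [sz hz] := vP z.
  split=> //; rewrite add0r; move: hz; rewrite weight_killing.
  by have := c0 z; have := v1 z; nra.
have vc := superharmonic_const ntr v_sh.
have [z cz] := killing_neq0 ntr.
have cz0 : 0 < c z by rewrite lt_neqAle eq_sym cz c0.
have [_] := vP z; rewrite (_ : v = fun=> v x); last by apply/funext => t; exact: vc.
rewrite (neighbor_sum_cst graph_bc) => h.
have : 1 <= v x by nra.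
by move=> vx1; rewrite vE; congr EFin; apply/eqP; rewrite eq_le v1.
Qed.

(** Nonnegative superharmonic functions being constant, a single point of [A] would make [A]
    thick. *)
Lemma recurrent_non_thick A : ~ transient o b no_killing -> non_thick b A ->
  A = set0.
Proof.
move=> ntr nA; apply/seteqP; split=> // a Aa; apply: nA => s Fs s0 Ls sA x.
have ss : superharmonic s by apply/superharmonicP.
by rewrite (superharmonic_const ntr ss x a); exact: sA.
Qed.

Lemma recurrent_esum A : ~ transient o b no_killing -> non_thick b A -> forall x,
  (\esum_(y in ~` A) (green o b no_killing x y * (c y)%:E))%E = +oo%E.
Proof.
move=> ntr nA x; rewrite (recurrent_non_thick ntr nA) setC0.
have [z cz] := killing_neq0 ntr.
have cz0 : 0 < c z by rewrite lt_neqAle eq_sym cz c0.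
rewrite /green asboolF//; apply/eqP; rewrite -leye_eq.
apply: (@le_trans _ _ (+oo * (c z)%:E)%E); first by rewrite gt0_mulye.
apply: (@term_le_esum _ _ (fun y => (+oo * (c y)%:E)%E)) => y.
by rewrite mule_ge0// lee_fin.
Qed.

(** * Thick sets and Gc = 1 when the graph without killing is transient *)

Section NoKillingTransient.
Hypothesis transient_b : transient o b no_killing.
Let bounded_b z : bounded_at b no_killing z :=
  transient_bounded_at no_killing_graph z transient_b.

Lemma thick_of_green_op_fin A x : (forall z, green_op o b c c z = 1%E) ->
  (green_op o b no_killing (fun y => (\1_(~` A) y * c y)%R) x < +oo)%E -> thick b A.
Proof.
move=> Gc1 Gfin s Fs s0 Ls sA.
set c2 := (fun y => _) in Gfin.
have c20 y : 0 <= c2 y by exact: restrict_ge0.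
have c2_out y : ~ A y -> c2 y = c y by move=> Ay; rewrite /c2 indicE mem_set// mul1r.
have [v vE] := green_op_real no_killing_graph connected_b bounded_b c20 Gfin.
have sv := green_op_supersolution no_killing_graph connected_b bounded_b c20 vE.
have [v0 vP] := (supersolutionP no_killing_graph _ c20).1 sv.
have ss : superharmonic s by apply/superharmonicP.
have [_ sP] := (supersolutionP no_killing_graph _ (fun=> lexx 0)).1 ss.
have s_v x' := neighbor_sumD (sP x').1 (vP x').1.
(* Where s + v > 1, the truncation is compared with the constant 1. Where s + v <= 1, either the
   vertex lies outside [A] and [v] supplies the source [c], or it lies in [A], and s >= 1 forces s +
   v = 1. *)
have w_sup : supersolution b c c (fun z => Num.min (s z + v z) 1).
  have m0 z : 0 <= Num.min (s z + v z) 1 by rewrite le_min ler01 andbT addr_ge0.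
  have ms z : 0 <= Num.min (s z + v z) 1 <= s z + v z by rewrite m0 ge_min lexx.
  have m1 z : 0 <= Num.min (s z + v z) 1 <= 1 by rewrite m0 ge_min lexx orbT.
  apply/(supersolutionP graph_bc) => //; split=> // z.
  have [ssv svE] := s_v z.
  have [sm h1] := neighbor_sum_le no_killing_graph ms ssv; split=> //.
  have [_] := neighbor_sum_le no_killing_graph m1 (abs_summable_cst no_killing_graph 1 z).
  rewrite neighbor_sum_cst_no_killing mulr1 => h2.
  rewrite weight_killing; have [_ hs] := sP z; have [_ hv] := vP z.
  case: (leP (s z + v z) 1) => [le1|lt1]; last by lra.
  have [Az|Az] := pselect (A z); last first.
    rewrite c2_out// in hv; rewrite svE in h1.
    by have := mulr_ge0 (c0 z) (addr_ge0 (s0 z) (v0 z)); lra.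
  have -> : s z + v z = 1.
    by apply/eqP; rewrite eq_le le1/=; have := sA z Az; have := v0 z; lra.
  lra.
have sv1 z : 1 <= s z + v z.
  have := green_op_le o graph_bc connected_b bounded_bc z c0 w_sup.
  by rewrite Gc1 lee_fin le_min => /andP[].
have u_sup : supersolution b no_killing c2 (fun z => s z + v z + - 1).
  apply/(supersolutionP no_killing_graph) => //; split=> [z|z].
    by rewrite subr_ge0.
  have [ssv svE] := s_v z.
  have [su uE] := neighbor_sumD ssv (abs_summable_cst no_killing_graph (-1) z).
  split=> //; rewrite uE svE neighbor_sum_cst_no_killing.
  by have [_ hs] := sP z; have [_ hv] := vP z; lra.
move=> z; have := green_op_le o no_killing_graph connected_b bounded_b z c20 u_sup.
by rewrite vE lee_fin; lra.
Qed.

Lemma green_op_kill_eq1 :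
  ~ (exists2 A, non_thick b A &
       bounded_above (green_op o b no_killing (fun y => \1_(~` A) y * c y))) ->
  forall x, green_op o b c c x = 1%E.
Proof.
move=> nA x; have [v [vE sv v1]] := green_op_kill_supersolution.
have [v0 vP] := (supersolutionP graph_bc _ c0).1 sv.
have v2 z := neighbor_sumZ 2 (vP z).1.
(* Removing the killing term c v from L v >= c leaves at least c (1 - v), which is nonnegative. *)
have v2_sh : superharmonic (fun z => 2 * v z).
  apply/(supersolutionP no_killing_graph) => //; split=> z; first by rewrite mulr_ge0.
  have [sz hz] := vP z; have [s2 E2] := v2 z; split=> //.
  rewrite add0r E2; move: hz; rewrite weight_killing.
  by have := mulr_ge0 (c0 z) (_ : 0 <= 1 - v z); rewrite subr_ge0 => /(_ (v1 z)); lra.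
have half z : 1 <= 2 * v z.
  pose A := [set z | 1 <= 2 * v z].
  apply: contrapT => vz; apply: nA; exists A.
    move=> /(_ (fun z => 2 * v z)) tA; apply: vz; apply: tA => //.
    - by have [] := (superharmonicP _).1 v2_sh.
    - by move=> t; rewrite mulr_ge0.
    - by have [] := (superharmonicP _).1 v2_sh.
  exists 2 => t; apply: (@le_trans _ _ (2 * v t)%:E); last first.
    by rewrite lee_fin -[leRHS]mulr1 ler_pM2l.
  have r0 y : 0 <= \1_(~` A) y * c y by exact: restrict_ge0.
  apply: (green_op_le o no_killing_graph connected_b bounded_b t r0 (w := fun z => 2 * v z)).
  apply/(supersolutionP no_killing_graph _ r0).
  split=> [y|y]; first by rewrite mulr_ge0.
  have [sz hz] := vP y; have [s2 E2] := v2 y; split=> //.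
  rewrite E2; move: hz; rewrite weight_killing.
  have := c0 y; have := v1 y; rewrite indicE.
  (* On [A] the source vanishes. Off [A] one has 2 v < 1, so the available 2 c (1 - v) is at least
     c. *)
  have [Ay|Ay] := pselect (A y).
    rewrite memNset//.
    by rewrite mul0r; nra.
  rewrite mem_set// mul1r; move: Ay => /negP; rewrite -ltNge; nra.
(* Since L 1 = c, the Laplacian of 2 v - 1 is at least 2 c - c; nonnegativity is [half]. *)
have sup21 : supersolution b c c (fun z => 2 * v z + - 1).
  apply/(supersolutionP graph_bc) => //; split=> z; first by rewrite subr_ge0.
  have [sz hz] := vP z; have [s2 E2] := v2 z.
  have [s3 E3] := neighbor_sumD s2 (abs_summable_cst graph_bc (-1) z).
  by split=> //; rewrite E3 E2 (neighbor_sum_cst graph_bc); lra.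
have := green_op_le o graph_bc connected_b bounded_bc x c0 sup21.
rewrite vE lee_fin => h; congr EFin; apply/eqP; rewrite eq_le v1/=; lra.
Qed.

End NoKillingTransient.

(** The terms with y in [A] vanish even when [green] is infinite, by the convention that infinity
    times 0 is 0. *)
Lemma green_op_restrict A x :
  green_op o b no_killing (fun y => \1_(~` A) y * c y) x =
  (\esum_(y in ~` A) (green o b no_killing x y * (c y)%:E))%E.
Proof.
rewrite esum_mkcond; apply: eq_esum => y _; rewrite indicE.
by case: (_ \in _); rewrite ?mul1r// mul0r mule0.
Qed.

Lemma green_ge0 x y : (0 <= green o b no_killing x y)%E.
Proof.
have [tr|ntr] := pselect (transient o b no_killing); last first.
  by rewrite /green asboolF.
have bnd z' := transient_bounded_at no_killing_graph z' tr.
rewrite greenE//; last exact: no_killing_graph.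
rewrite lee_fin green_lim_ge0// => z.
exact: (green_approx_bounded no_killing_graph).
Qed.

(** In the transient case finiteness at one vertex spreads along edges; otherwise every such sum is
    infinite. *)
Lemma esum_some_all A : non_thick b A ->
  (exists x, (\esum_(y in ~` A) (green o b no_killing x y * (c y)%:E))%E = +oo%E) ->
  forall x, (\esum_(y in ~` A) (green o b no_killing x y * (c y)%:E))%E = +oo%E.
Proof.
move=> nA [x Ex] z.
have [tr|ntr] := pselect (transient o b no_killing); last exact: recurrent_esum.
have bnd z' := transient_bounded_at no_killing_graph z' tr.
apply/eqP; rewrite -leye_eq leNgt; apply/negP.
rewrite -green_op_restrict => /(green_op_fin no_killing_graph connected_b bnd x).
by rewrite green_op_restrict Ex => /(_ (restrict_ge0 _)).
Qed.

End Transient.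
End Killing.

Theorem theorem16 (R : realType) (X : countType) (o : X)
    (b : X -> X -> R) (c : X -> R)
    (graph_bc : is_graph b c) (connected_b : graph_connected b)
    (transient_bc : transient o b c) :
  let Gb := green o b no_killing in
  let Gb_op := green_op o b no_killing in
  [<-> (* (ii) *)
       forall x, green_op o b c c x = 1%E;
       (* (v), some x *)
       forall A, non_thick b A ->
         exists x, (\esum_(y in ~` A) (Gb x y * (c y)%:E))%E = +oo%E;
       (* (v), all x *)
       forall A, non_thick b A ->
         forall x, (\esum_(y in ~` A) (Gb x y * (c y)%:E))%E = +oo%E;
       (* (v.a) *)
       ~ (exists c1 c2, [/\ decomposition c c1 c2,
            exists2 A, non_thick b A & supported_in A c1 &
            bounded_above (Gb_op c2)]);
       (* (v.a), restricted decompositions *)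
       ~ (exists2 A, non_thick b A &
            bounded_above (Gb_op (fun y => \1_(~` A) y * c y)));
       (* (v.b) *)
       ~ (exists c1 c2, [/\ decomposition c c1 c2,
            exists2 A, non_thick b A & supported_in A c1 &
            finite_everywhere (Gb_op c2)]);
       (* (v.b), restricted decompositions *)
       ~ (exists2 A, non_thick b A &
            finite_everywhere (Gb_op (fun y => \1_(~` A) y * c y)))]
  /\ (* in (v), some x and all x are equivalent for each fixed A *)
  (forall A, non_thick b A ->
     (exists x, (\esum_(y in ~` A) (Gb x y * (c y)%:E))%E = +oo%E) <->
     (forall x, (\esum_(y in ~` A) (Gb x y * (c y)%:E))%E = +oo%E)).
Proof.
move=> Gb Gb_op.
have some_all A : non_thick b A ->
    (exists x, (\esum_(y in ~` A) (Gb x y * (c y)%:E))%E = +oo%E) ->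
    forall x, (\esum_(y in ~` A) (Gb x y * (c y)%:E))%E = +oo%E.
  exact: esum_some_all.
split; last by move=> A nA; split=> [|h]; [exact: some_all|exists o].
have ii_v : (forall x, green_op o b c c x = 1%E) -> forall A, non_thick b A ->
    exists x, (\esum_(y in ~` A) (Gb x y * (c y)%:E))%E = +oo%E.
  move=> Gc1 A nA; exists o.
  have [tr|ntr] := pselect (transient o b no_killing); last exact: recurrent_esum.
  apply/eqP; rewrite -leye_eq leNgt; apply/negP => fin; apply: nA.
  apply: (thick_of_green_op_fin graph_bc connected_b transient_bc tr (x := o) Gc1).
  by rewrite green_op_restrict.
(* Outside [A] the part [c1] vanishes and [c2] equals [c], so a general decomposition does no better
   than cutting [c] along [A]. *)
have fin_restrict c1 c2 A x : decomposition c c1 c2 -> supported_in A c1 ->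
    (Gb_op c2 x < +oo)%E -> (\esum_(y in ~` A) (Gb x y * (c y)%:E) < +oo)%E.
  move=> [cE c10 c20] c1A; apply: le_lt_trans; rewrite esum_mkcond.
  apply: le_esum => y _; case: ifPn => [/set_mem /= Ay|_].
    by rewrite cE c1A// add0r.
  by rewrite mule_ge0 ?lee_fin//; exact: (green_ge0 o graph_bc connected_b).
have restrict_dec A : decomposition c (fun y => \1_A y * c y) (fun y => \1_(~` A) y * c y).
  split=> [y|y|y]; rewrite ?indicE ?in_setC; try by rewrite mulr_ge0// (graph_kill_ge0 graph_bc).
  by case: (_ \in _); rewrite mul1r mul0r ?addr0 ?add0r.
have restrict_supp A : supported_in A (fun y => \1_A y * c y).
  by move=> y Ay; rewrite indicE memNset// mul0r.
have va'_ii : ~ (exists2 A, non_thick b A &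
      bounded_above (Gb_op (fun y => \1_(~` A) y * c y))) ->
    forall x, green_op o b c c x = 1%E.
  move=> nA; have [tr|ntr] := pselect (transient o b no_killing).
    exact: green_op_kill_eq1.
  exact: recurrent_green_op_kill.
have v_vb : (forall A, non_thick b A ->
      forall x, (\esum_(y in ~` A) (Gb x y * (c y)%:E))%E = +oo%E) ->
    ~ (exists c1 c2, [/\ decomposition c c1 c2,
            exists2 A, non_thick b A & supported_in A c1 &
            finite_everywhere (Gb_op c2)]).
  move=> vA [c1 [c2 [dec [A nA c1A] fin]]].
  by have := fin_restrict _ _ _ _ dec c1A (fin o); rewrite vA.
tfae.
- exact: ii_v.
- by move=> h A nA; apply: some_all => //; exact: h.
- move=> /v_vb nvb [c1 [c2 [dec h [M hM]]]]; apply: nvb; exists c1, c2; split => // x.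
  exact: le_lt_trans (hM x) (ltry M).
- move=> nva [A nA h]; apply: nva.
  exists (fun y => \1_A y * c y), (fun y => \1_(~` A) y * c y); split => //.
  by exists A.
(* A finite [Gb_op c2] need not be bounded, so the passage from bounded to finite potentials goes
   back to (ii) and from there through (v). *)
- by move=> /va'_ii /ii_v h; apply: v_vb => A nA; exact/some_all/h.
- move=> nvb [A nA h]; apply: nvb.
  exists (fun y => \1_A y * c y), (fun y => \1_(~` A) y * c y); split => //.
  by exists A.
- move=> nvb; apply: va'_ii => -[A nA [M hM]]; apply: nvb; exists A => // x.
  exact: le_lt_trans (hM x) (ltry M).
Qed.
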